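(* Let $F\subset\mathbb R^d$ be a generalized Sierpiński carpet with approximating domains $F_m$, and let $\{\alpha_m\}_{m\ge0}$ be a sequence with $0<\inf_m\alpha_m\le\sup_m\alpha_m<\infty$ such that, whenever $x_m\in F_m$ and $x_m\to x\in F$, $(X^{(F_m)}_{\alpha_mt})_{t\ge0}$ started from $x_m$ converges weakly in $C([0,\infty);\mathbb R^d)$ to $(X^{(F)}_t)_{t\ge0}$ started from $x$. Then $\alpha_m\mathcal E^{(F_m)}$ on $L^2(F_m;\mu_m)$ is Mosco convergent to $\mathcal E^{(F)}$ on $L^2(F;\mu)$ as $m\to\infty$.
   Context: Generalized Sierpiński carpet (GSC). Let $d\ge 2$, $L_F\ge 3$ be integers, $F_0=[0,1]^d$, and for $n\ge 0$ let $\mathcal Q_n$ be the set of the $L_F^{nd}$ closed cubes $\prod_{i=1}^d[(l_i-1)L_F^{-n},l_iL_F^{-n}]$, $1\le l_i\le L_F^n$. For $A\subset\mathbb R^d$ put $\mathcal Q_n(A)=\{Q\in\mathcal Q_n:\operatorname{int}(Q)\cap A\ne\emptyset\}$. For $Q\in\mathcal Q_n$ with lower corner $a_Q$, $\Psi_Q(x)=a_Q+L_F^{-n}x$ maps $F_0$ onto $Q$. Let $F_1\subsetneq F_0$ be a union of cubes in $\mathcal Q_1$, $F_n=\bigcup_{Q\in\mathcal Q_1(F_1)}\Psi_Q(F_{n-1})$ for $n\ge 2$, and $F=\bigcap_{n\ge 0}F_n$. $F$ is a GSC if: (SC1) $F_1$ is preserved by all isometries of $F_0$; (SC2) $\operatorname{int}(F_1)$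 is connected; (SC3) if $n\ge 1$ and $B\subset F_0$ is a cube of side length $2L_F^{-n}$ that is the union of $2^d$ distinct elements of $\mathcal Q_n$, then $\operatorname{int}(F_1\cap B)$ is connected whenever it is non-empty; (SC4) $F_1$ contains the segment $\{0\le x_1\le 1,\ x_2=\dots=x_d=0\}$. Put $m_F=\#\mathcal Q_1(F)$, $d_f=\log m_F/\log L_F$. $\mu$ is the $d_f$-dimensional Hausdorff measure on $F$ normalized so that $\mu(F)=1$; $\mu_m$ is Lebesgue measure on $F_m$ normalized so that $\mu_m(F_m)=1$. Walk dimension. The resistance scaling factor $\rho_F>0$ is the unique number such that, for some $C\ge 1$ and all $n\ge0$, $C^{-1}\le (\rho_FL_F^{d-2})^n\inf\{\int_{F_n}|\nabla f|^2dx: f\in W^{1,2}(F_n)\cap C(F_n), f=0 \text{ on }F_n\cap\{x_1=0\}, f=1\text{ on }F_n\cap\{x_1=1\}\}\le C$ (existence of $\rho_F$ is known). $d_w=\log(\rho_Fm_F)/\log L_F$. Forms and processes on $F_m$. $\mathcal E^{(F_m)}(f,g)=L_F^{(d_w-2)m}\int_{F_m}\nabla f\cdot\nabla g\,d\mu_m$ for $f,g\in W^{1,2}(F_m)$; $X^{(F_m)}$ is the diffusion (time-changed reflected Brownian motion) associated with $(\mathcal E^{(F_m)},W^{1,2}(F_m))$ on $L^2(F_m;\mu_m)$; it can be started from every point of $F_m$. Locally symmetric forms. For $Q\in\mathcal Q_n(F)$ put $F_Q=F\cap Q$ and let $\varphi_Q:F\to F_Q$ be the folding map $(\varphi_Q(x))_i=(a_Q)_i+L_F^{-n}\varphi_0(L_F^n(x_i-(a_Q)_i))$,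 where $\varphi_0$ is the 2-periodic function with $\varphi_0(t)=|t|$ on $[-1,1]$. For a Dirichlet form $(\mathcal E,\mathcal F)$ on $L^2(F;\mu)$ let $\mathcal F^Q=\{g:F_Q\to\mathbb R: g\circ\varphi_Q\in\mathcal F\}$ and $\mathcal E^Q(g,g)=m_F^{-n}\mathcal E(g\circ\varphi_Q,g\circ\varphi_Q)$. The form is locally symmetric if for every $n\ge 0$: (1) $f|_{F_Q}\in\mathcal F^Q$ for $f\in\mathcal F$, $Q\in\mathcal Q_n(F)$; (2) if $Q_1,Q_2\in\mathcal Q_n(F)$ and $\Phi$ is an isometry of $\mathbb R^d$ mapping $Q_1$ onto $Q_2$, then $f\in\mathcal F^{Q_2}$ implies $f\circ\Phi\in\mathcal F^{Q_1}$ and $\mathcal E^{Q_1}(f\circ\Phi,f\circ\Phi)=\mathcal E^{Q_2}(f,f)$; (3) $\mathcal E(f,f)=\sum_{Q\in\mathcal Q_n(F)}\mathcal E^Q(f|_{F_Q},f|_{F_Q})$ for $f\in\mathcal F$. Brownian motion on $F$. It is known (Barlow–Bass–Kumagai–Teplyaev) that non-zero strongly local, regular, irreducible, locally symmetric Dirichlet forms on $L^2(F;\mu)$ exist and are unique up to a positive multiple, and that the associated diffusion can be started from every point of $F$. $(\mathcal E^{(F)},\mathcal F^{(F)})$ is the one whose diffusion $X^{(F)}$, started from $\mathbf 0=(0,\dots,0)$, has mean hitting time $1$ of the union of the faces of $\partial F_0$ not containing $\mathbf 0$. (A sequence $\{\alpha_m\}$ as in the claim is known to exist.) Mosco convergence.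 Fix Borel maps $\mathcal I_n:F_n\to F$ with $\sup_{x\in F_n}|\mathcal I_n(x)-x|\to 0$ (the notions below do not depend on the choice). $f_n\in L^2(F_n;\mu_n)$ converges strongly in $L^2$ to $f\in L^2(F;\mu)$ if there are $u_j\in C(F)$ with $\|u_j-f\|_{L^2(F;\mu)}\to 0$ and $\lim_{j}\limsup_{n}\|f_n-u_j\circ\mathcal I_n\|_{L^2(F_n;\mu_n)}=0$; it converges weakly in $L^2$ to $f$ if $(f_n,g_n)_{L^2(F_n;\mu_n)}\to(f,g)_{L^2(F;\mu)}$ whenever $g_n\to g$ strongly in $L^2$. Closed non-negative forms are viewed as quadratic forms $\mathcal E(f)=\mathcal E(f,f)$, equal to $+\infty$ off the domain. $\mathcal E^{(n)}$ on $L^2(F_n;\mu_n)$ is Mosco convergent to $\mathcal E$ on $L^2(F;\mu)$ if (M1) $\liminf_n\mathcal E^{(n)}(f_n)\ge\mathcal E(f)$ whenever $f_n\to f$ weakly in $L^2$; (M2) each $f\in L^2(F;\mu)$ admits $f_n\to f$ strongly in $L^2$ with $\limsup_n\mathcal E^{(n)}(f_n)\le\mathcal E(f)$. *)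

(* Defs.v *)
From HB Require Import structures.
From mathcomp Require Import all_boot all_order all_algebra.
From mathcomp Require Import all_classical all_reals all_analysis.
Set Implicit Arguments.
Unset Strict Implicit.
Unset Printing Implicit Defensive.
Import Order.TTheory GRing.Theory Num.Theory.
Import numFieldNormedType.Exports.
Local Open Scope classical_set_scope.
Local Open Scope ring_scope.

(* Every matrix space, in particular R^d = 'rV[R]_d, carries its Borel
   sigma-algebra. *)
HB.instance Definition _ (R : realType) (m n : nat) :=
  Measurable.copy 'M[R]_(m, n) (g_sigma_algebraType (@open 'M[R]_(m, n))).

Section Euclidean.
Context {R : realType} {d : nat}.
Local Notation V := 'rV[R]_d.

(* The library norm `|x| of 'rV[R]_d is the sup norm: same topology, but not
   the same distances. *)
Definition enorm (x : V) : R := Num.sqrt (\sum_i x 0 i ^+ 2).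

Definition ediam (A : set V) : \bar R :=
  maxe 0%E (ereal_sup [set (enorm (p.1 - p.2))%:E | p in A `*` A]).

Definition hausdorff_content (s : R) (delta : R) (A : set V) : \bar R :=
  ereal_inf [set (\sum_(0 <= k <oo) ediam (U k) `^ s)%E | U in
    [set U : nat -> set V | A `<=` \bigcup_k U k /\
                            forall k, (ediam (U k) <= delta%:E)%E]].

Definition hausdorff_measure (s : R) (A : set V) : \bar R :=
  ereal_sup [set hausdorff_content s delta A | delta in [set delta : R | 0 < delta]].

Definition is_lebesgue (lam : set V -> \bar R) :=
  forall a b : V, (forall i, a 0 i <= b 0 i) ->
    lam [set x | forall i, a 0 i <= x 0 i <= b 0 i] =
      (\prod_i (b 0 i - a 0 i))%:E.

(* mu is the multiple of the restriction of nu to K; for a probability mu, this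
   is nu restricted to K and normalized by mu K = 1. *)
Definition normalized_restriction (nu : set V -> \bar R) (K : set V)
    (mu : set V -> \bar R) :=
  exists2 c : R, 0 < c &
    forall A, measurable A -> mu A = (c%:E * nu (A `&` K))%E.

End Euclidean.

Section Carpet.
Context {R : realType} {d : nat} (L : nat).
Local Notation V := 'rV[R]_d.
(* Q indexes the cube of Q_n with lower corner Q / L^n. *)
Local Notation idx n := {ffun 'I_d -> 'I_(L ^ n)}.

Definition unit_cube : set V := [set x | forall i, 0 <= x 0 i <= 1].

Definition corner n (Q : idx n) : V := \row_i ((Q i)%:R / L%:R ^+ n).

Definition cube_at (a : V) (r : R) : set V :=
  [set x | forall i, a 0 i <= x 0 i <= a 0 i + r].

Definition cube n (Q : idx n) : set V := cube_at (corner Q) (L%:R ^- n).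

Definition cells n (A : set V) : set (idx n) :=
  [set Q | (cube Q)° `&` A !=set0].
Arguments cells n A _ : clear implicits.

Definition ncells n (A : set V) : nat := #|[pred Q | Q \in cells n A]|.

Definition Psi n (Q : idx n) (x : V) : V := corner Q + L%:R ^- n *: x.

Definition subdivide (F1 A : set V) : set V :=
  \bigcup_(Q in cells 1 F1) (Psi Q @` A).

(* F_0 is the unit cube, F_1 is given, F_(n.+2) refines F_(n.+1). *)
Definition prefractal (F1 : set V) (n : nat) : set V :=
  if n is n'.+1 then iter n' (subdivide F1) F1 else unit_cube.

Definition carpet (F1 : set V) : set V := \bigcap_n prefractal F1 n.

Definition isometry_on (A : set V) (Phi : V -> V) :=
  forall x y, A x -> A y -> enorm (Phi x - Phi y) = enorm (x - y).

Record is_GSC (F1 : set V) : Prop := {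
  gsc_cells : exists S : set (idx 1), F1 = \bigcup_(Q in S) cube Q;
  gsc_proper : F1 <> unit_cube;
  gsc_symmetric : forall Phi : V -> V, isometry_on unit_cube Phi ->
    Phi @` unit_cube = unit_cube -> Phi @` F1 = F1;
  gsc_connected : connected (F1°);
  gsc_nondiagonal : forall n (a : V) (S : {set idx n}), (1 <= n)%N ->
    let B := cube_at a (2 * L%:R ^- n) in
    #|S| = (2 ^ d)%N -> B = \bigcup_(Q in [set` S]) cube Q ->
    (F1 `&` B)° !=set0 -> connected ((F1 `&` B)°);
  gsc_borders : [set x : V | unit_cube x /\
    forall i : 'I_d, i != 0%N :> nat -> x 0 i = 0] `<=` F1
}.

Definition ncopies (F1 : set V) : nat := ncells 1 (carpet F1).

Definition hausdorff_dim (F1 : set V) : R := ln (ncopies F1)%:R / ln L%:R.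

Definition walk_dim (F1 : set V) (rho : R) : R :=
  ln (rho * (ncopies F1)%:R) / ln L%:R.

(* The 2-periodic function equal to `|t| on [-1, 1]. *)
Definition phi0 (t : R) : R := `|t - 2 * (Num.floor ((t + 1) / 2))%:~R|.

Definition fold_map n (Q : idx n) (x : V) : V :=
  \row_i (corner Q 0 i +
          L%:R ^- n * phi0 (L%:R ^+ n * (x 0 i - corner Q 0 i))).

Definition far_faces : set V :=
  [set x | unit_cube x /\ exists i, x 0 i = 1].

End Carpet.
Arguments cells {R d} L n A _.

Section L2.
Context {R : realType} {d : nat}.
Local Notation V := 'rV[R]_d.
Context (mu : {measure set V -> \bar R}) (K : set V).

(* A function on K is represented by any function on R^d with these values on
   K, an element of L^2(K; mu) by any function of its class. *)
Definition L2norm (f : V -> R) : \bar R := ('N[mu]_2%:E[EFin \o (f \_ K)])%E.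

Definition L2 : set (V -> R) :=
  [set f | measurable_fun K f /\ (L2norm f < +oo)%E].

Definition L2inner (f g : V -> R) : R := \int[mu]_(x in K) (f x * g x).

Definition aeeq (f g : V -> R) := {ae mu, forall x, K x -> f x = g x}.

Definition CK : set (V -> R) := [set f | {within K, continuous f}].

End L2.

Section Sobolev.
Context {R : realType} {d : nat}.
Local Notation V := 'rV[R]_d.

Definition pderiv (i : 'I_d) (f : V -> R) : V -> R :=
  fun x => 'D_(delta_mx 0 i) f x.

Definition smooth (f : V -> R) := forall s : seq 'I_d,
  let g := foldr pderiv f s in
  continuous g /\ forall i x, derivable g x (delta_mx 0 i).

Definition test_function (U : set V) (phi : V -> R) :=
  smooth phi /\ exists K : set V,
    [/\ compact K, K `<=` U & forall x, ~ K x -> phi x = 0].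

Context (lam : {measure set V -> \bar R}) (K : set V).

Definition is_weak_grad (f : V -> R) (g : V -> V) :=
  (forall i, L2 lam K (fun x => g x 0 i)) /\
  forall i phi, test_function (K°) phi ->
    \int[lam]_(x in K°) (f x * pderiv i phi x) =
    - \int[lam]_(x in K°) (g x 0 i * phi x).

Definition W12 : set (V -> R) :=
  [set f | L2 lam K f /\ exists g, is_weak_grad f g].

(* Well defined up to a lam-null set for f in W12. *)
Definition weak_grad (f : V -> R) : V -> V := get (is_weak_grad f).

Definition grad_dot (f g : V -> R) (x : V) : R :=
  \sum_i weak_grad f x 0 i * weak_grad g x 0 i.

End Sobolev.

Record dform (R : realType) (d : nat) := DForm {
  fdom : set ('rV[R]_d -> R);
  fval : ('rV[R]_d -> R) -> ('rV[R]_d -> R) -> R }.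

Section DirichletForms.
Context {R : realType} {d : nat}.
Local Notation V := 'rV[R]_d.

Definition qform (E : dform R d) (f : V -> R) : \bar R :=
  if `[< fdom E f >] then (fval E f f)%:E else +oo%E.

Context (mu : {measure set V -> \bar R}) (K : set V).

Definition val1 (E : dform R d) (f : V -> R) : R :=
  fval E f f + L2inner mu K f f.

Record is_dirichlet_form (E : dform R d) : Prop := {
  df_L2 : fdom E `<=` L2 mu K;
  df_ae : forall f g, fdom E f -> L2 mu K g -> aeeq mu K f g ->
    fdom E g /\ forall h, fdom E h -> fval E f h = fval E g h;
  df_dom0 : fdom E (cst 0);
  df_domD : forall (a : R) f g, fdom E f -> fdom E g -> fdom E (a \*o f \+ g);
  df_linear : forall (a : R) f g h, fdom E f -> fdom E g -> fdom E h ->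
    fval E (a \*o f \+ g) h = a * fval E f h + fval E g h;
  df_sym : forall f g, fdom E f -> fdom E g -> fval E f g = fval E g f;
  df_ge0 : forall f, fdom E f -> 0 <= fval E f f;
  df_dense : forall f (e : R), L2 mu K f -> 0 < e ->
    exists2 g, fdom E g & (L2norm mu K (f \- g)%R < e%:E)%E;
  df_closed : forall u : nat -> V -> R, (forall n, fdom E (u n)) ->
    (forall e : R, 0 < e -> exists N, forall m n,
      (N <= m)%N -> (N <= n)%N -> val1 E (u m \- u n) < e) ->
    exists2 f, fdom E f & val1 E (u n \- f) @[n --> \oo] --> (0 : R);
  df_markov : forall f, fdom E f ->
    let g := fun x => Num.min (Num.max 0 (f x)) 1 in
    fdom E g /\ fval E g g <= fval E f f
}.

(* T is the strongly continuous symmetric contraction semigroup on L^2(K; mu)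
   whose closed form is E: E(f, f) is the limit (in [0, +oo]) of
   (f - T_t f, f) / t as t decreases to 0, and the domain of E consists of those
   f in L^2 for which this limit is finite. *)
Record is_semigroup_of (E : dform R d) (T : R -> (V -> R) -> V -> R) : Prop := {
  sg_L2 : forall (t : R) f, 0 <= t -> L2 mu K f -> L2 mu K (T t f);
  sg_ae : forall (t : R) f g, 0 <= t -> L2 mu K f -> L2 mu K g -> aeeq mu K f g ->
    aeeq mu K (T t f) (T t g);
  sg_linear : forall (t a : R) f g, 0 <= t -> L2 mu K f -> L2 mu K g ->
    aeeq mu K (T t (a \*o f \+ g)) (a \*o T t f \+ T t g);
  sg_sym : forall (t : R) f g, 0 <= t -> L2 mu K f -> L2 mu K g ->
    L2inner mu K (T t f) g = L2inner mu K f (T t g);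
  sg_contraction : forall (t : R) f, 0 <= t -> L2 mu K f ->
    (L2norm mu K (T t f) <= L2norm mu K f)%E;
  sg_add : forall (s t : R) f, 0 <= s -> 0 <= t -> L2 mu K f ->
    aeeq mu K (T (s + t) f) (T s (T t f));
  sg_continuous : forall f, L2 mu K f ->
    L2norm mu K (T t f \- f) @[t --> (0 : R)^'+] --> (0 : \bar R)%E;
  sg_dom : fdom E `<=` L2 mu K;
  sg_form : forall f, L2 mu K f ->
    (L2inner mu K (f \- T t f) f / t)%:E @[t --> (0 : R)^'+] --> qform E f
}.

Definition nonzero_form (E : dform R d) := exists2 f, fdom E f & fval E f f != 0.

Definition regular (E : dform R d) :=
  (forall f (e : R), fdom E f -> 0 < e ->
     exists2 g, fdom E g /\ CK K g & val1 E (f \- g) < e) /\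
  (forall f (e : R), CK K f -> 0 < e ->
     exists2 g, fdom E g /\ CK K g & forall x, K x -> `|f x - g x| < e).

Definition irreducible (E : dform R d) :=
  forall T, is_semigroup_of E T ->
  forall A : set V, measurable A -> A `<=` K ->
    (forall (t : R) f, 0 < t -> L2 mu K f ->
       aeeq mu K (T t (f \_ A)) ((T t f) \_ A)) ->
    mu A = 0%E \/ mu (K `\` A) = 0%E.

Definition support_of (f : V -> R) : set V :=
  [set x | K x /\ forall U : set V, open U -> U x ->
    ~ aeeq mu (K `&` U) f (cst 0)].

Definition strongly_local (E : dform R d) :=
  forall f g, fdom E f -> fdom E g ->
    compact (support_of f) -> compact (support_of g) ->
    (exists U : set V, [/\ open U, support_of f `<=` U &
       exists c : R, aeeq mu (K `&` U) g (cst c)]) ->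
    fval E f g = 0.

End DirichletForms.

Section LocallySymmetric.
Context {R : realType} {d : nat} (L : nat).
Local Notation V := 'rV[R]_d.
Local Notation idx n := {ffun 'I_d -> 'I_(L ^ n)}.
Context (F1 : set V) (E : dform R d).

(* An element of F^Q is a function on the cell F_Q; as fold_map Q maps F into
   F_Q, its values off F_Q do not matter, and restriction to F_Q is omitted. *)
Definition cell_dom n (Q : idx n) : set (V -> R) :=
  [set g : V -> R | fdom E (g \o fold_map Q)].

Definition cell_val n (Q : idx n) (g : V -> R) : R :=
  (ncopies L F1)%:R ^- n * fval E (g \o fold_map Q) (g \o fold_map Q).

Definition locally_symmetric := forall n,
  [/\ forall f (Q : idx n), fdom E f -> cells L n (carpet L F1) Q -> cell_dom Q f,
      forall (Q1 Q2 : idx n) (Phi : V -> V),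
        cells L n (carpet L F1) Q1 -> cells L n (carpet L F1) Q2 ->
        isometry_on setT Phi -> Phi @` cube Q1 = cube Q2 ->
        forall f, cell_dom Q2 f ->
          cell_dom Q1 (f \o Phi) /\ cell_val Q1 (f \o Phi) = cell_val Q2 f
    & forall f, fdom E f -> fval E f f =
        \sum_(Q : idx n | Q \in cells L n (carpet L F1)) cell_val Q f].

End LocallySymmetric.

Definition halfline (R : realType) : Type := set_type [set` `[(0 : R), +oo[].
HB.instance Definition _ (R : realType) :=
  Topological.copy (halfline R) (set_type [set` `[(0 : R), +oo[]).

(* C([0, oo); R^d) with the topology of locally uniform convergence and its
   Borel sigma-algebra. *)
Definition cpath (R : realType) (d : nat) : Type :=
  continuousType (halfline R) 'rV[R]_d.

HB.instance Definition _ R d := Choice.on (cpath R d).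
HB.instance Definition _ (R : realType) (d : nat) :=
  isPointed.Build (cpath R d) (cst 0 : continuousType _ _).
HB.instance Definition _ (R : realType) (d : nat) :=
  Topological.copy (cpath R d)
    (initial_topology (fun w : cpath R d =>
       (w : halfline R -> 'rV[R]_d) : {compact-open, halfline R -> 'rV[R]_d})).
HB.instance Definition _ (R : realType) (d : nat) :=
  Measurable.copy (cpath R d) (g_sigma_algebraType (@open (cpath R d))).

Section Paths.
Context {R : realType} {d : nat}.
Local Notation V := 'rV[R]_d.

Lemma clock_subproof (t : R) : Num.max t 0 \in [set` `[(0 : R), +oo[].
Proof. by apply/mem_set; rewrite /= in_itv /= andbT le_max lexx orbT. Qed.

(* The time t, for t >= 0. *)
Definition clock (t : R) : halfline R :=
  exist (fun s : R => s \in [set` `[(0 : R), +oo[]) _ (clock_subproof t).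

Definition at_time (t : R) (w : cpath R d) : V := w (clock t).

Lemma rescale_continuous (a : R) :
  continuous (fun t : halfline R => clock (a * set_val t)).
Proof.
apply: continuous_comp_initial => t /=.
rewrite [X in continuous_at _ X](_ : _ = (fun s : R => Num.max (a * s) 0) \o set_val) //.
apply: continuous_comp; first exact: initial_continuous.
apply: (@continuous_max _ _ (fun s : R => a * s) (fun=> 0)).
  exact: mulrl_continuous.
exact: cst_continuous.
Qed.

(* The path t |-> w (a t), for a >= 0. *)
Definition time_change (a : R) (w : cpath R d) : cpath R d :=
  (w : continuousType _ _) \o mkcts (@rescale_continuous a).

Definition hitting_time (B : set V) (w : cpath R d) : \bar R :=
  ereal_inf [set t%:E | t in [set t : R | 0 <= t /\ B (at_time t w)]].

Definition past (s : R) : set (set (cpath R d)) :=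
  <<s [set A | exists (t : R) (B : set V),
         [/\ 0 <= t <= s, measurable B & A = at_time t @^-1` B]] >>.

Definition transition (K : set V) (P : V -> probability (cpath R d) R)
    (t : R) (f : V -> R) (x : V) : R :=
  \int[P x]_w (f \_ K) (at_time t w).

(* P x is the law of the process started from x, for x in K.  The Feller
   property determines P x for every x in K, rather than only outside an
   exceptional set, from the semigroup on L^2, and with the Markov property and
   the continuity of paths it implies the strong Markov property. *)
Record is_diffusion (K : set V) (P : V -> probability (cpath R d) R) : Prop := {
  diff_start : forall x, K x -> P x [set w | at_time 0 w = x] = 1%E;
  diff_stay : forall x, K x ->
    P x [set w | forall t : R, 0 <= t -> K (at_time t w)] = 1%E;
  diff_feller : forall (t : R) f, 0 <= t -> CK K f -> CK K (transition K P t f);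
  diff_markov : forall x (s t : R) (A : set (cpath R d)) (f : V -> R),
    K x -> 0 <= s -> 0 <= t -> past s A ->
    measurable_fun K f -> (exists M : R, forall y, K y -> `|f y| <= M) ->
    \int[P x]_(w in A) (f \_ K) (at_time (s + t) w) =
    \int[P x]_(w in A) (transition K P t f \_ K) (at_time s w)
}.

Definition is_diffusion_of (mu : {measure set V -> \bar R}) (K : set V)
    (E : dform R d) (P : V -> probability (cpath R d) R) :=
  is_diffusion K P /\ is_semigroup_of mu K E (transition K P).

(* Weak convergence in C([0, oo); R^d) of the law of Y n under P n to Q. *)
Definition cvg_in_law (P : nat -> probability (cpath R d) R)
    (Y : nat -> cpath R d -> cpath R d) (Q : probability (cpath R d) R) :=
  forall Phi : cpath R d -> R, continuous Phi ->
    (exists M : R, forall w, `|Phi w| <= M) ->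
    \int[P n]_w Phi (Y n w) @[n --> \oo] --> \int[Q]_w Phi w.

End Paths.

Section CarpetForms.
Context {R : realType} {d : nat} (L : nat).
Local Notation V := 'rV[R]_d.
Context (F1 : set V) (lam : {measure set V -> \bar R}).

Definition crossing_energies (n : nat) : set R :=
  let K := prefractal L F1 n in
  [set \int[lam]_(x in K) grad_dot lam K f f x | f in
    [set f | [/\ W12 lam K f, CK K f,
      (forall x (i : 'I_d), K x -> i = 0%N :> nat -> x 0 i = 0 -> f x = 0)
    & (forall x (i : 'I_d), K x -> i = 0%N :> nat -> x 0 i = 1 -> f x = 1)]]].

Definition is_resistance_factor (rho : R) := 0 < rho /\
  exists2 C : R, 1 <= C & forall n,
    C^-1 <= (rho * L%:R ^+ (d - 2)) ^+ n * inf (crossing_energies n) <= C.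

Definition prefractal_form (rho : R) (m : nat) (mum : {measure set V -> \bar R}) :
    dform R d :=
  let K := prefractal L F1 m in
  DForm (W12 lam K)
    (fun f g => L%:R `^ ((walk_dim L F1 rho - 2) * m%:R) *
                \int[mum]_(x in K) grad_dot lam K f g x).

(* All the conditions but the last determine E up to a positive multiple. *)
Record is_carpet_BM (mu : {measure set V -> \bar R}) (E : dform R d)
    (P : V -> probability (cpath R d) R) : Prop := {
  bm_dirichlet : is_dirichlet_form mu (carpet L F1) E;
  bm_nonzero : nonzero_form E;
  bm_strongly_local : strongly_local mu (carpet L F1) E;
  bm_regular : regular mu (carpet L F1) E;
  bm_irreducible : irreducible mu (carpet L F1) E;
  bm_locally_symmetric : locally_symmetric L F1 E;
  bm_diffusion : is_diffusion_of mu (carpet L F1) E P;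
  bm_normalized : (\int[P 0%R]_w hitting_time far_faces w = 1)%E
}.

End CarpetForms.

Section Mosco.
Context {R : realType} {d : nat}.
Local Notation V := 'rV[R]_d.
Context (Kn : nat -> set V) (mun : forall n : nat, {measure set V -> \bar R})
        (In : nat -> V -> V) (K : set V) (mu : {measure set V -> \bar R}).

Definition identification_maps :=
  (forall n, measurable_fun (Kn n) (In n) /\ In n @` Kn n `<=` K) /\
  ereal_sup [set (enorm (In n x - x))%:E | x in Kn n] @[n --> \oo]
    --> (0 : \bar R)%E.

Definition strong_cvg (fn : nat -> V -> R) (f : V -> R) :=
  [/\ forall n, L2 (mun n) (Kn n) (fn n), L2 mu K f &
    exists u : nat -> V -> R,
      [/\ forall j, CK K (u j),
          L2norm mu K (u j \- f) @[j --> \oo] --> (0 : \bar R)%E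
        & limn_esup (fun n => L2norm (mun n) (Kn n) (fn n \- (u j \o In n)))
            @[j --> \oo] --> (0 : \bar R)%E]].

Definition weak_cvg (fn : nat -> V -> R) (f : V -> R) :=
  [/\ forall n, L2 (mun n) (Kn n) (fn n), L2 mu K f &
    forall gn g, strong_cvg gn g ->
      L2inner (mun n) (Kn n) (fn n) (gn n) @[n --> \oo] --> L2inner mu K f g].

Definition mosco (En : nat -> (V -> R) -> \bar R) (E : (V -> R) -> \bar R) :=
  (forall fn f, weak_cvg fn f ->
     (E f <= limn_einf (fun n => En n (fn n)))%E) /\
  (forall f, L2 mu K f -> exists2 fn, strong_cvg fn f &
     (limn_esup (fun n => En n (fn n)) <= E f)%E).

End Mosco.

(* Main.v *)
Require Import Defs.
From mathcomp Require Import all_boot all_order all_algebra.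
From mathcomp Require Import all_classical all_reals all_analysis.
From mathcomp Require Import measurable_realfun ring lra.
Set Implicit Arguments.
Unset Strict Implicit.
Unset Printing Implicit Defensive.
Import Order.TTheory GRing.Theory Num.Theory.
Import numFieldNormedType.Exports.
Local Open Scope classical_set_scope.
Local Open Scope ring_scope.

(** Let T^m_t be the semigroup of the diffusion on F_m run at speed alpha_m, and T_t
    that of the diffusion on F.  Mosco convergence of the forms is what convergence
    of the semigroups says about energies, and the proof has three parts.

    Semigroups.  Let u be continuous on F, with continuous extension v.  The
    hypothesis on the laws says that T^m_t v (x_m) -> T_t u (x) whenever x_m -> x, and
    by compactness this convergence is uniform (sequential_limit_uniform).  Since the
    measures are probabilities and the T^m_t are contractions, T^m_t f_m -> T_t f
    strongly whenever f_m -> f strongly (strong_cvg_transition).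

    Measures.  Inner products pass to the limit along strongly convergent sequences
    (strong_cvg_inner) because mu_m -> mu weakly.  Indeed, if N is the number of cells
    of F_1, both mu_m and mu are carried by the N^m cells of level m, and no cell has
    mass more than N^-m: for mu by the scaling of the Hausdorff measure of dimension
    log N / log L, for mu_m because the cells have equal volumes and disjoint
    interiors.  So the integrals of a continuous function against mu_m and mu differ
    from its average over the lower corners of these cells by at most its oscillation
    on a cell (cover_integral_average, prefractal_weak_cvg).

    Energies.  Put E^t(f) = (f - T_t f, f) / t.  As (T_t f, f) = |T_(t/2) f|^2 is a
    convex function of t,
      E(T_(t/2) f) <= E^t(f) <= E(f),
    and E^t(f) -> E(f) as t -> 0 (semigroup_quotient_le_form,
    form_semigroup_le_quotient); likewise for E^m := alpha_m E^(F_m).  Let f_m -> f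
    weakly and g_m -> f strongly.  Then
      E^m(f_m) >= E^(m,t)(f_m) >= 2 E^(m,t)(f_m, g_m) - E^(m,t)(g_m) -> E^t(f),
    which gives the lower bound as t -> 0.  On the other hand the functions
    T^m_(t/2) g_m converge strongly to T_(t/2) f, and
      E^m(T^m_(t/2) g_m) <= E^(m,t)(g_m) -> E^t(f) <= E(f),
    so that a diagonal sequence with t -> 0 has the required upper bound. *)

(** * The Hilbert space L^2(K; nu) *)

Section L2theory.
Context {R : realType} {d : nat}.
Local Notation V := 'rV[R]_d.
Context (nu : {measure set V -> \bar R}) (K : set V) (mK : measurable K).
Implicit Types (f g h : V -> R).

Lemma L2norm_sqr f :
  (L2norm nu K f `^ 2 = \int[nu]_(x in K) (f x ^+ 2)%:E)%E.
Proof.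
rewrite /L2norm poweR_Lnorm; last by rewrite pnatr_eq0.
rewrite [RHS]integral_mkcond; apply: eq_integral => x _ /=.
rewrite !patchE; case: ifPn => _ /=; last by rewrite normr0 powR0// pnatr_eq0.
by rewrite powR_mulrn// -normrX ger0_norm// sqr_ge0.
Qed.

Lemma L2P f : L2 nu K f <->
  measurable_fun K f /\ nu.-integrable K (EFin \o (fun x => f x ^+ 2)).
Proof.
split=> -[mf].
  move=> fy; split=> //; apply/integrableP; split.
    by apply/measurable_EFinP; exact: measurable_funX.
  under eq_integral => x _ do rewrite /= ger0_norm ?sqr_ge0//.
  rewrite -L2norm_sqr; exact: poweR_lty.
move=> /integrableP[_]; under eq_integral => x _ do rewrite /= ger0_norm ?sqr_ge0//.
rewrite -L2norm_sqr => fy; split=> //.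
rewrite ltey; apply/negP => /eqP E; move: fy; rewrite E.
by rewrite /poweR /= pnatr_eq0.
Qed.

Lemma L2_integrableM f g : L2 nu K f -> L2 nu K g ->
  nu.-integrable K (EFin \o (fun x => f x * g x)).
Proof.
move=> /L2P[mf If] /L2P[mg Ig].
have Ifg := integrableD mK If Ig.
apply: le_integrable Ifg => //.
  by apply/measurable_EFinP; exact: measurable_funM.
move=> x _ /=; rewrite lee_fin; rewrite ler_norml; apply/andP; split.
  rewrite ger0_norm ?addr_ge0 ?sqr_ge0//.
  have : 0 <= (f x + g x) ^+ 2 by rewrite sqr_ge0.
  have : 0 <= f x ^+ 2 + g x ^+ 2 by rewrite addr_ge0 ?sqr_ge0.
  nra.
rewrite ger0_norm ?addr_ge0 ?sqr_ge0//.
have : 0 <= (f x - g x) ^+ 2 by rewrite sqr_ge0.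
have : 0 <= f x ^+ 2 + g x ^+ 2 by rewrite addr_ge0 ?sqr_ge0.
nra.
Qed.

Lemma L2B f g : L2 nu K f -> L2 nu K g -> L2 nu K (f \- g).
Proof.
move=> Lf Lg; apply/L2P; have /L2P[mf If] := Lf; have /L2P[mg Ig] := Lg.
split; first exact: measurable_funB.
have I1 := integrableD mK If Ig.
have I2 := integrableB mK I1 (integrableZl mK 2 (L2_integrableM Lf Lg)).
apply: eq_integrable I2 => // x _ /=.
by rewrite -!EFinD; congr EFin; ring.
Qed.

Local Notation inner := (L2inner nu K).
(** A real-valued version of L2norm, so that the parallelogram and polarization
    identities can be used without extended reals. *)
Definition L2nrm f : R := Num.sqrt (inner f f).

Lemma innerC f g : inner f g = inner g f.
Proof. by apply: eq_Rintegral => x _; rewrite mulrC. Qed.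

Lemma innerBl f g h : L2 nu K f -> L2 nu K g -> L2 nu K h ->
  inner (f \- g) h = inner f h - inner g h.
Proof.
move=> Lf Lg Lh; rewrite -RintegralB//; last 2 first.
  exact: L2_integrableM.
  exact: L2_integrableM.
by apply: eq_Rintegral => x _ /=; rewrite mulrBl.
Qed.

Lemma innerBr f g h : L2 nu K f -> L2 nu K g -> L2 nu K h ->
  inner h (f \- g) = inner h f - inner h g.
Proof. by move=> *; rewrite innerC innerBl// [inner _ f]innerC [inner _ g]innerC. Qed.

Lemma inner_ge0 f : 0 <= inner f f.
Proof. by apply: Rintegral_ge0 => x _; rewrite -expr2 sqr_ge0. Qed.

Lemma sqr_L2nrm f : L2nrm f ^+ 2 = inner f f.
Proof. by rewrite sqr_sqrtr// inner_ge0. Qed.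

Lemma L2nrm_ge0 f : 0 <= L2nrm f.
Proof. exact: sqrtr_ge0. Qed.

Lemma L2normE f : L2 nu K f -> L2norm nu K f = (L2nrm f)%:E.
Proof.
move=> /L2P[mf If].
have : (L2norm nu K f `^ 2 = (L2nrm f)%:E `^ 2)%E.
  rewrite L2norm_sqr poweR_EFin powR_mulrn ?L2nrm_ge0// sqr_L2nrm.
  rewrite /L2inner /Rintegral fineK; last exact: integrable_fin_num.
  by apply: eq_integral => x _; rewrite expr2.
move=> /(congr1 (fun z => z `^ 2^-1)%E).
rewrite -!poweRrM mulfV ?pnatr_eq0// poweRe1; last exact: Lnorm_ge0.
by rewrite poweRe1 ?lee_fin ?L2nrm_ge0.
Qed.

Lemma L2nrmB_le f g : L2 nu K f -> L2 nu K g ->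
  L2nrm (f \- g) <= L2nrm f + L2nrm g.
Proof.
move=> Lf Lg; rewrite -lee_fin EFinD -!L2normE//; last exact: L2B.
rewrite /L2norm.
have -> : (f \- g) \_ K = (f \_ K) \+ (\- (g \_ K)).
  by apply/funext => x; rewrite /= !patchE; case: ifP; rewrite ?oppr0 ?addr0.
have mr h : L2 nu K h -> measurable_fun [set: V] (h \_ K).
  by move=> [mh _]; apply/(measurable_restrictT _ _).1.
apply: le_trans (minkowski_EFin _ _ _ _) _ => //.
- exact: mr.
- by apply: measurableT_comp => //; exact: mr.
- by rewrite ler1n.
by rewrite leeD2l// -[leRHS]oppe_Lnorm.
Qed.

Lemma L2nrmBC f g : L2nrm (f \- g) = L2nrm (g \- f).
Proof.
by congr Num.sqrt; apply: eq_Rintegral => x _ /=; rewrite -[f x - g x]opprB mulrNN.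
Qed.

Lemma L2nrm_triangle g f h : L2 nu K f -> L2 nu K g -> L2 nu K h ->
  L2nrm (f \- h) <= L2nrm (f \- g) + L2nrm (g \- h).
Proof.
move=> Lf Lg Lh.
rewrite [leRHS](_ : _ = L2nrm (f \- g) + L2nrm (h \- g)); last by rewrite [X in _ + X]L2nrmBC.
rewrite [X in L2nrm X](_ : _ = (f \- g) \- (h \- g)).
  by apply: L2nrmB_le => //; exact: L2B.
by apply/funext => x /=; ring.
Qed.

Lemma L2nrm_dist f g : L2 nu K f -> L2 nu K g -> `|L2nrm f - L2nrm g| <= L2nrm (f \- g).
Proof.
move=> Lf Lg; have Z h : (h \- (cst 0 : V -> R))%R = h by apply/funext => x /=; rewrite subr0.
have L0 : L2 nu K (cst 0).
  apply/L2P; split; first exact: measurable_cst.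
  apply: eq_integrable (integrable0 nu K) => // x _ /=.
  by rewrite expr0n.
have := L2nrm_triangle Lf Lg L0; have := L2nrm_triangle Lg Lf L0.
rewrite !Z [L2nrm (g \- f)]L2nrmBC ler_norml => A B; apply/andP; split; lra.
Qed.

Lemma inner_polar f g : L2 nu K f -> L2 nu K g ->
  inner f g = (L2nrm f ^+ 2 + L2nrm g ^+ 2 - L2nrm (f \- g) ^+ 2) / 2.
Proof.
move=> Lf Lg; rewrite !sqr_L2nrm innerBl//; last exact: L2B.
by rewrite !innerBr// [inner g f]innerC; field.
Qed.

Lemma aeeq_inner f g h : L2 nu K f -> L2 nu K g -> L2 nu K h ->
  aeeq nu K f g -> inner f h = inner g h.
Proof.
move=> Lf Lg Lh fg; congr fine; apply: ae_eq_integral => //.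
- by have /integrableP[] := L2_integrableM Lf Lh.
- by have /integrableP[] := L2_integrableM Lg Lh.
by apply: filterS fg => x /= fg Kx; rewrite fg.
Qed.

End L2theory.

(** A probability measure turns uniform bounds into L^2 bounds; this is how uniform
    convergence of continuous functions becomes strong convergence. *)
Lemma L2_bounded {R : realType} {d : nat} (nu : probability 'rV[R]_d R) (K : set 'rV[R]_d)
    (f : 'rV[R]_d -> R) (e : R) :
  measurable K -> measurable_fun K f -> 0 <= e -> (forall x, K x -> `|f x| <= e) ->
  L2 nu K f /\ L2nrm nu K f <= e.
Proof.
move=> mK mf e0 fe.
have Ie : nu.-integrable K (EFin \o (fun=> e ^+ 2)).
  exact: finite_measure_integrable_cst.
have If : nu.-integrable K (EFin \o (fun x => f x ^+ 2)).
  apply: le_integrable Ie => //.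
    by apply/measurable_EFinP; exact: measurable_funX.
  move=> x Kx /=; rewrite lee_fin !normrX lerXn2r ?nnegrE// (le_trans (fe _ Kx))//.
  exact: ler_norm.
have Lf : L2 nu K f by apply/L2P.
split=> //; rewrite -(ler_sqr (L2nrm_ge0 _ _ _))// sqr_L2nrm.
have : L2inner nu K f f <= \int[nu]_(x in K) e ^+ 2.
  rewrite (_ : L2inner nu K f f = \int[nu]_(x in K) (f x ^+ 2)).
    by apply: le_Rintegral => // x Kx; rewrite -[f x ^+ 2]ger0_norm ?sqr_ge0// normrX lerXn2r ?nnegrE// fe.
  by apply: eq_Rintegral => x _; rewrite expr2.
move=> /le_trans; apply; rewrite Rintegral_cst//.
rewrite ler_piMr ?sqr_ge0// -lee_fin fineK ?probability_le1//.
exact: fin_num_measure.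
Qed.

(** * Difference quotients of a symmetric semigroup *)

(** For a sequence with nonincreasing steps, the average step over the first n lies
    between the n-th step and the first one. *)
Lemma convex_seq_slopes (R : realFieldType) (p : nat -> R) :
  (forall k, 2 * p k.+1 <= p k + p k.+2) -> forall n,
  n%:R * (p n - p n.+1) <= p 0%N - p n <= n%:R * (p 0%N - p 1%N).
Proof.
move=> cp; have dec j k : (j <= k)%N -> p k - p k.+1 <= p j - p j.+1.
  move=> /subnKC <-; elim: (k - j)%N => [|i IH]; first by rewrite addn0.
  by apply: le_trans IH; rewrite addnS; have := cp (j + i)%N; lra.
move=> n; apply/andP; split.
  elim: n => [|n IH]; first by rewrite mul0r subrr.
  have := ler_wpM2l (ler0n _ n) (dec _ _ (leqnSn n)).
  have := dec _ _ (leqnSn n).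
  rewrite -[n.+1%:R]natr1 mulrDl mul1r; lra.
elim: n => [|n IH]; first by rewrite mul0r subrr.
have := dec _ _ (leq0n n); rewrite -[n.+1%:R]natr1 mulrDl mul1r; lra.
Qed.

Lemma cvg_seq_at_right (R : realType) (T : topologicalType) (g : R -> T) (l : T)
    (u : nat -> R) : (forall n, 0 < u n) -> u n @[n --> \oo] --> (0 : R) ->
  g t @[t --> (0 : R)^'+] --> l -> g (u n) @[n --> \oo] --> l.
Proof.
move=> u0 cu; apply: cvg_comp => A /= [e e0 eA].
move/cvgrPdist_lt : cu => /(_ _ e0); apply: filterS => n /= un.
by apply: eA => //=.
Qed.

Section Semigroup.
Context {R : realType} {d : nat}.
Local Notation V := 'rV[R]_d.
Context (nu : {measure set V -> \bar R}) (K : set V) (mK : measurable K).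
Context (E : dform R d) (T : R -> (V -> R) -> V -> R).
Hypothesis sgT : is_semigroup_of nu K E T.
Implicit Types (f g : V -> R) (t : R).
Local Notation inner := (L2inner nu K).
Local Notation nrm := (L2nrm nu K).
Local Notation LT := (sg_L2 sgT).

(** By symmetry half of the time can be moved to the other factor; in particular
    (T_2s f, f) is a square norm. *)
Lemma semigroup_inner_add s t f : 0 <= s -> 0 <= t -> L2 nu K f ->
  inner (T (s + t) f) f = inner (T s f) (T t f).
Proof.
move=> s0 t0 Lf; rewrite (aeeq_inner _ _ _ _ (sg_add sgT s0 t0 Lf))//.
- by rewrite (sg_sym sgT)//; [exact: innerC | exact: LT].
- by apply: LT => //; exact: addr_ge0.
- by apply: LT => //; exact: LT.
Qed.

Lemma semigroup_contraction t f : 0 <= t -> L2 nu K f -> nrm (T t f) <= nrm f.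
Proof.
by move=> t0 Lf; rewrite -lee_fin -!L2normE//; [exact: (sg_contraction sgT)|exact: LT].
Qed.

(** This is |T_a f - T_b f|^2 >= 0 expanded, where 2a and 2b are the outer times, and
    |f - T_h f|^2 >= 0 for k = 0.  The value at time 0 is (f, f), the one that occurs in
    the difference quotients, instead of (T_0 f, f). *)
Lemma semigroup_convex h f : 0 < h -> L2 nu K f ->
  let p k := if k is 0%N then inner f f else inner (T (k%:R * h) f) f in
  forall k, 2 * p k.+1 <= p k + p k.+2.
Proof.
move=> h0 Lf /= k; have sq g : 0 <= inner g g := inner_ge0 _ _ _.
case: k => [|k].
  have -> : 2 * h = h + h by ring.
  rewrite semigroup_inner_add ?(ltW h0)// mul1r.
  have LTf : L2 nu K (T h f) by apply: LT => //; exact: ltW.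
  have := sq (f \- T h f); rewrite innerBl// ?innerBr//; last exact: L2B.
  rewrite [inner f (T h f)]innerC; lra.
pose a := k.+1%:R * h / 2; pose b := k.+3%:R * h / 2.
have a0 : 0 <= a by rewrite divr_ge0// mulr_ge0// ltW.
have b0 : 0 <= b by rewrite divr_ge0// mulr_ge0// ltW.
rewrite (_ : k.+2%:R * h = a + b); last by rewrite /a /b -!natr1; field.
rewrite (_ : k.+1%:R * h = a + a); last by rewrite /a; field.
rewrite (_ : k.+3%:R * h = b + b); last by rewrite /b; field.
rewrite !semigroup_inner_add//.
have La := LT a0 Lf; have Lb := LT b0 Lf.
have := sq (T a f \- T b f); rewrite innerBl// ?innerBr//; last exact: L2B.
rewrite [inner (T b f) (T a f)]innerC; lra.
Qed.

Lemma semigroup_quotient_ge0 t f : 0 <= t -> L2 nu K f -> 0 <= inner (f \- T t f) f.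
Proof.
move=> t0 Lf; have t20 : 0 <= t / 2 by rewrite divr_ge0.
rewrite innerBl//; last exact: LT.
rewrite {1}(splitr t) semigroup_inner_add// subr_ge0 -!sqr_L2nrm.
by rewrite lerXn2r ?nnegrE ?L2nrm_ge0 ?semigroup_contraction.
Qed.

Let step t n : R := t / n.+1%:R.

Let step_gt0 t n : 0 < t -> 0 < step t n.
Proof. by move=> t0; rewrite divr_gt0. Qed.

Let cvg_step t : step t n @[n --> \oo] --> (0 : R).
Proof. by rewrite -(mulr0 t); apply: cvgM; [exact: cvg_cst|exact: cvg_harmonic]. Qed.

Let form_step t f : 0 < t -> L2 nu K f ->
  (inner (f \- T (step t n) f) f / step t n)%:E @[n --> \oo] --> qform E f.
Proof.
move=> t0 Lf; apply: cvg_seq_at_right (sg_form sgT Lf) => [n|]; last exact: cvg_step.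
exact: step_gt0.
Qed.

(** The difference quotients of a convex function at 0 increase as the step
    decreases, here along the steps t / (n + 1), to the value of the form. *)
Lemma semigroup_quotient_le_form t f : 0 < t -> L2 nu K f ->
  ((inner (f \- T t f) f / t)%:E <= qform E f)%E.
Proof.
move=> t0 Lf; apply: cvge_to_ge (form_step t0 Lf) _; apply: nearW => n.
rewrite lee_fin; have h0 := step_gt0 n t0; set h := step t n in h0 *.
have tE : t = n.+1%:R * h by rewrite /h /step mulrC divfK// pnatr_eq0.
have /andP[_] := convex_seq_slopes (semigroup_convex h0 Lf) n.+1.
rewrite /= -tE mul1r => le; rewrite !innerBl//; [|exact: LT (ltW _) _|exact: LT (ltW _) _].
rewrite ler_pdivrMr// mulrAC ler_pdivlMr//.
by apply: le_trans (ler_wpM2r (ltW h0) le) _; rewrite mulrAC -tE mulrC.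
Qed.

(** The form at T_(t/2) f is minus the right derivative of (T_s f, f) at s = t, which
    by convexity is at most minus the mean slope over [0, t].  In spectral terms this
    is the inequality x <= e^x - 1. *)
Lemma form_semigroup_le_quotient t f : 0 < t -> L2 nu K f ->
  (qform E (T (t / 2) f) <= (inner (f \- T t f) f / t)%:E)%E.
Proof.
move=> t0 Lf; have t20 : 0 <= t / 2 by rewrite divr_ge0// ltW.
have Lg := LT t20 Lf.
apply: cvge_to_le (form_step t0 Lg) _; apply: nearW => n.
rewrite lee_fin; have h0 := step_gt0 n t0; set h := step t n in h0 *.
have tE : t = n.+1%:R * h by rewrite /h /step mulrC divfK// pnatr_eq0.
have /andP[+ _] := convex_seq_slopes (semigroup_convex h0 Lf) n.+1.
rewrite /= -tE => le.
have E1 : inner (T (t / 2) f) (T (t / 2) f) = inner (T t f) f.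
  by rewrite {3}(splitr t) semigroup_inner_add.
(* (T_s f, f) one step h = t / (n + 1) after s = t. *)
have E2 : inner (T h (T (t / 2) f)) (T (t / 2) f) = inner (T (n.+2%:R * h) f) f.
  have -> : n.+2%:R * h = (h + t / 2) + t / 2.
    rewrite -addrA -splitr tE -[n.+2%:R]natr1; ring.
  have ht0 : 0 <= h + t / 2 by rewrite addr_ge0// ltW.
  rewrite semigroup_inner_add//.
  symmetry; apply: aeeq_inner (sg_add sgT (ltW h0) t20 Lf) => //; first exact: LT.
  exact: LT (ltW _) _.
rewrite !innerBl//; [|exact: LT (ltW _) _|exact: LT (ltW _) _].
rewrite E1 E2 ler_pdivrMr// mulrAC ler_pdivlMr//.
apply: le_trans (ler_wpM2r (ltW h0) le); by rewrite mulrAC -tE mulrC.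
Qed.

(** Linearity is only almost everywhere, because the semigroup acts on
    representatives. *)
Lemma semigroupB t f g : 0 <= t -> L2 nu K f -> L2 nu K g ->
  aeeq nu K (T t (f \- g)) (T t f \- T t g).
Proof.
move=> t0 Lf Lg; have := sg_linear sgT (-1) t0 Lg Lf.
rewrite (_ : (-1) \*o g \+ f = f \- g); last by apply/funext => x /=; ring.
by rewrite (_ : (-1) \*o T t g \+ T t f = T t f \- T t g)//; apply/funext => x /=; ring.
Qed.

Lemma semigroup_lipschitz t f g : 0 <= t -> L2 nu K f -> L2 nu K g ->
  nrm (T t f \- T t g) <= nrm (f \- g).
Proof.
move=> t0 Lf Lg; have Lfg := L2B mK Lf Lg; have LTfg := LT t0 Lfg.
have LB : L2 nu K (T t f \- T t g) by apply: L2B => //; exact: LT.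
have ae := semigroupB t0 Lf Lg.
apply: le_trans (semigroup_contraction t0 Lfg).
rewrite /L2nrm ler_wsqrtr// (aeeq_inner mK _ _ LTfg ae)// innerC.
by rewrite (aeeq_inner mK _ _ LB ae)// innerC.
Qed.

Lemma cvg_semigroup (u : nat -> R) f : (forall n, 0 < u n) ->
  u n @[n --> \oo] --> (0 : R) -> L2 nu K f ->
  nrm (T (u n) f \- f) @[n --> \oo] --> (0 : R).
Proof.
move=> u0 cu Lf; have := cvg_seq_at_right u0 cu (sg_continuous sgT Lf).
rewrite (_ : (fun n => _) = EFin \o (fun n => nrm (T (u n) f \- f))).
  by move/fine_cvg.
apply/funext => n /=; rewrite L2normE//; apply: L2B => //.
exact: LT (ltW _) _.
Qed.
End Semigroup.

(** * Continuous functions on compact subsets of R^d *)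

Section Euclid.
Context {R : realType} {d : nat}.
Local Notation V := 'rV[R]_d.

Lemma open_measurable_rV (A : set V) : open A -> measurable A.
Proof. by move=> oA; apply: sub_sigma_algebra. Qed.

Lemma closed_measurable_rV (A : set V) : closed A -> measurable A.
Proof.
move=> cA; rewrite -(setCK A); apply: measurableC; apply: open_measurable_rV.
exact: closed_openC.
Qed.

Lemma continuous_measurable_rV (f : V -> R) : continuous f -> measurable_fun setT f.
Proof.
move=> /continuousP cf; apply: (measurability _ (RGenOpens.measurableE R)).
move=> _ [_ [a [b ->] <-]]; rewrite setTI.
by apply: open_measurable_rV; apply: cf; exact: interval_open.
Qed.

(** Tietze: weak convergence of measures and convergence in law speak of functions
    on the whole space, strong convergence of functions on K. *)
Lemma compact_extension (K : set V) (u : V -> R) : compact K -> CK K u ->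
  exists v : V -> R, [/\ forall x, K x -> u x = v x, continuous v
    & exists2 M : R, 0 < M & forall x, `|v x| <= M].
Proof.
move=> cK cu; have [M [Mreal uM]] := compact_bounded (continuous_compact cu cK).
pose N := `|M| + 1; have N0 : 0 < N by rewrite ltr_wpDl.
have MN : M < N by rewrite /N (le_lt_trans (ler_norm _))// ltrDl.
have uN x : K x -> `|u x| <= N by move=> Kx; apply: (uM _ MN) => /=; exists x.
have [v [uv cv vN]] := continuous_bounded_extension (@pseudometric_normal R V)
  (compact_closed (@norm_hausdorff _ _) cK) N0 cu uN.
exists v; split => //; last by exists N.
by move=> x Kx; apply: uv; apply/mem_set.
Qed.

Lemma CK_measurable (K : set V) (u : V -> R) : compact K -> CK K u -> measurable_fun K u.
Proof.
move=> cK cu; have mK := closed_measurable_rV (compact_closed (@norm_hausdorff _ _) cK).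
have [v [uv cv _]] := compact_extension cK cu.
apply: (eq_measurable_fun v) => [x /set_mem/uv//|].
by apply: measurable_funTS; exact: continuous_measurable_rV.
Qed.

Lemma CK_bounded (K : set V) (u : V -> R) : compact K -> CK K u ->
  exists2 M : R, 0 < M & forall x, K x -> `|u x| <= M.
Proof.
move=> cK cu; have [v [uv _ [M M0 vM]]] := compact_extension cK cu.
by exists M => // x /uv ->.
Qed.

Lemma CK_B (K : set V) (u v : V -> R) : CK K u -> CK K v -> CK K (u \- v).
Proof. move=> cu cv; exact: (within_continuousB cu cv). Qed.

Lemma rV_norm_le (x : V) (e : R) : 0 <= e -> (forall i, `|x 0 i| <= e) -> `|x| <= e.
Proof.
move=> e0 xe; rewrite [`|x|](mx_normrE x); apply: bigmax_le => // -[i j] _ /=.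
by rewrite ord1.
Qed.

Lemma norm_le_enorm (x : V) : `|x| <= enorm x.
Proof.
apply: rV_norm_le => [|i]; first exact: sqrtr_ge0.
rewrite -sqrtr_sqr ler_wsqrtr// (bigD1 i)//= lerDl.
by apply: sumr_ge0 => j _; exact: sqr_ge0.
Qed.

Lemma unit_cube_compact : compact (@unit_cube R d).
Proof.
have -> : @unit_cube R d = [set v | forall i, `[0, 1]%classic (v ord0 i)].
  by apply/seteqP; split=> x /= h i; have := h i; rewrite in_itv.
by apply: (@rV_compact R d (fun=> `[0, 1]%classic)) => i; exact: segment_compact.
Qed.
End Euclid.

(** * From sequential to uniform convergence *)

Section UniformConvergence.
Context {R : realType} {d : nat}.
Local Notation V := 'rV[R]_d.
Context (Kn : nat -> set V) (K : set V) (In : nat -> V -> V).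
Hypothesis KKn : forall n, K `<=` Kn n.
Hypothesis hIn : identification_maps Kn In K.
Hypothesis cK : compact K.

Lemma identification_near (e : R) : 0 < e ->
  \forall n \near \oo, forall y, Kn n y -> `|In n y - y| < e.
Proof.
move=> e0; have [_ /fine_cvgP[fin /cvgrPdist_lt/(_ e e0) small]] := hIn.
near=> n => y Ky; apply: le_lt_trans (norm_le_enorm _) _.
have finn : ereal_sup [set (enorm (In n x - x))%:E | x in Kn n] \is a fin_num.
  by near: n.
have : `|0 - fine (ereal_sup [set (enorm (In n x - x))%:E | x in Kn n])| < e.
  by near: n.
rewrite sub0r normrN => /(le_lt_trans (ler_norm _)); apply: le_lt_trans.
rewrite -lee_fin fineK//; apply: ereal_sup_ubound; by exists y.
Unshelve. all: by end_near. Qed.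

(** Convergence along sequences gives convergence along the product filter at x: a
    choice of bad points y_k in the domains of index f k >= k, with y_k -> x, would
    yield a bad sequence once it is completed by the constant x.  That sequence
    converges because only finitely many indices are of the form f k with k < k0. *)
Lemma sequential_limit_local (h : nat -> V -> R) (x : V) (l : R) : K x ->
  (forall x_, (forall m, Kn m (x_ m)) -> x_ m @[m --> \oo] --> x ->
     h m (x_ m) @[m --> \oo] --> l) ->
  forall e : R, 0 < e -> exists2 del : R, 0 < del &
    \forall m \near \oo, forall y, Kn m y -> `|y - x| < del -> `|h m y - l| < e.
Proof.
move=> Kx hx e e0; apply: contrapT => noP.
have bad k : exists my : nat * V, [/\ (k <= my.1)%N, Kn my.1 my.2,
    `|my.2 - x| < k.+1%:R^-1 & e <= `|h my.1 my.2 - l|].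
  apply: contrapT => nobad; apply: noP; exists k.+1%:R^-1; first by rewrite invr_gt0.
  exists k => // m /= km y Ky yx; rewrite ltNge; apply/negP => le.
  by apply: nobad; exists (m, y).
have {bad} [f bad] := choice bad.
pose x_ m := if pselect (exists k, (f k).1 = m) is left ex
             then (f (projT1 (cid ex))).2 else x.
have x_Kn m : Kn m (x_ m).
  rewrite /x_; case: pselect => [ex|_]; last exact: KKn.
  case: (cid ex) => k /= <-; by case: (bad k).
(* Beyond all f k with k < k0, every selected point has an index k >= k0. *)
have x_cvg : x_ m @[m --> \oo] --> x.
  apply/cvgrPdist_lt => r r0.
  have /cvgrPdist_lt/(_ r r0)[k0 _ hk0] := @cvg_harmonic R.
  exists (\max_(k < k0) (f k).1).+1 => // m /= mk.
  rewrite /x_; case: pselect => [ex|_]; last by rewrite subrr normr0.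
  case: (cid ex) => k /= fkm; have [kk0|k0k] := ltnP k k0.
    have := leq_bigmax (F := fun k : 'I_k0 => (f k).1) (Ordinal kk0).
    by rewrite /= fkm leqNgt mk.
  case: (bad k) => _ _ lt _; rewrite distrC; apply: lt_trans lt _.
  by have := hk0 k k0k; rewrite /= sub0r normrN ger0_norm ?invr_ge0.
have /cvgrPdist_lt/(_ e e0)[N _ hN] := hx _ x_Kn x_cvg.
have := hN _ (let: And4 kf _ _ _ := bad N in kf).
rewrite /x_; case: pselect => [ex|]; last by case; exists N.
case: (cid ex) => k /= fk; rewrite distrC -fk.
by case: (bad k) => _ _ _ le; rewrite ltNge le.
Qed.

(** Local convergence at each point of K becomes uniform by compactness, in the
    form of the near-covering property; a point y of the n-th domain is attached to
    the point In n y of K, which is close to y. *)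
Lemma sequential_limit_uniform (h : nat -> V -> R) (H : V -> R) :
  (forall x_ x, (forall m, Kn m (x_ m)) -> K x -> x_ m @[m --> \oo] --> x ->
     h m (x_ m) @[m --> \oo] --> H x) ->
  CK K H ->
  forall e : R, 0 < e -> \forall m \near \oo, forall y, Kn m y ->
    `|h m y - H (In m y)| < e.
Proof.
move=> hx cH e e0; have e20 : 0 < e / 2 by rewrite divr_gt0.
suff : \forall m \near \oo, K `<=` [set z | forall y, Kn m y -> In m y = z ->
    `|h m y - H z| < e].
  apply: filterS => m Km y Ky; apply: Km => //.
  by have [/(_ m)[_ Im] _] := hIn; apply: Im; exists y.
have := (compact_near_coveringP K).1 cK; move/near_covering_withinP; apply => x Kx.
have [del del0 hloc] := sequential_limit_local Kx (fun x_ K1 K2 => hx x_ x K1 Kx K2) e20.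
have : \forall z \near x, K z -> `|H x - H z| < e / 2.
  have /cvgrPdist_lt/(_ _ e20) := cH x.
  move=> cHx; have : within K (nbhs x) [set z | `|H x - H z| < e / 2] by rewrite nbhs_subspace_in.
  by [].
move=> Hx.
have del20 : 0 < del / 2 by rewrite divr_gt0.
have zx : \forall z \near x, `|z - x| < del / 2.
  apply: (@cvgr_distC_lt _ _ _ (nbhs x) _ (fun z => z) x) => //.
have Ig := identification_near del20.
near=> z m => /= Kz y Ky yz.
have gap : `|In m y - y| < del / 2 by exact: (near Ig m).
have zx' : `|z - x| < del / 2 by near: z.
have yx : `|y - x| < del.
  rewrite yz distrC in gap; rewrite -[y - x](subrKA z).
  by rewrite (le_lt_trans (ler_normD _ _))// (splitr del) ltrD.
have hyx : `|h m y - H x| < e / 2 by apply: (near hloc m).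
have Hxz : `|H x - H z| < e / 2 by move: Kz; near: z.
rewrite -[h m y - H z](subrKA (H x)) (le_lt_trans (ler_normD _ _))//.
by rewrite (splitr e) ltrD.
Unshelve. all: by end_near. Qed.
End UniformConvergence.

(** * Geometry of the prefractals and of the carpet *)

Section CarpetGeometry.
Context {R : realType} {d L : nat}.
Local Notation V := 'rV[R]_d.
Local Notation idx n := {ffun 'I_d -> 'I_(L ^ n)}.
Local Notation Lr := (L%:R : R).
Local Notation Cube := (@unit_cube R d).
Local Notation one := (const_mx 1 : V).
Hypothesis hL : (3 <= L)%N.

Definition open_cube : set V := [set x | forall i, 0 < x 0 i < 1].

Let L_gt0 : 0 < Lr. Proof. by rewrite ltr0n (leq_trans _ hL). Qed.
Let L_neq0 : Lr != 0. Proof. by rewrite gt_eqF. Qed.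

Lemma PsiE (Q : idx 1) (x : V) i : (Psi Q x) 0 i = ((Q i)%:R + x 0 i) / Lr.
Proof. by rewrite /Psi /corner !mxE !expr1 mulrDl [_^-1 * _]mulrC. Qed.

Lemma Psi_inj (Q : idx 1) : injective (@Psi R d L 1 Q).
Proof.
move=> x y /rowP xy; apply/rowP => i; have := xy i.
by rewrite !PsiE => /(mulIf (invr_neq0 L_neq0))/addrI.
Qed.

Definition Psi_inv (Q : idx 1) (x : V) : V := \row_i (Lr * x 0 i - (Q i)%:R).

Lemma Psi_invK (Q : idx 1) : cancel (Psi_inv Q) (Psi Q).
Proof. by move=> x; apply/rowP => i; rewrite PsiE mxE addrC subrK mulrC mulKf. Qed.

Lemma cubeE (Q : idx 1) : cube Q = Psi Q @` Cube.
Proof.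
apply/seteqP; split=> x.
  move=> h; exists (Psi_inv Q x); last exact: Psi_invK.
  move=> i; have := h i; rewrite /corner !mxE !expr1 => /andP[lo hi].
  rewrite subr_ge0 lerBlDl -ler_pdivrMl// mulrC lo/=.
  by rewrite -ler_pdivlMl// mulrC mulrDl mul1r.
move=> [y Cy <-] i; rewrite PsiE /corner !mxE !expr1 mulrDl.
by have /andP[y0 y1] := Cy i; rewrite lerDl divr_ge0 ?(ltW L_gt0)//= lerD2l ler_piMl ?invr_ge0 ?(ltW L_gt0).
Qed.

Lemma Psi_open_cube (Q : idx 1) x : open_cube x -> open_cube (Psi Q x).
Proof.
move=> ox i; have /andP[x0 x1] := ox i.
rewrite PsiE divr_gt0 ?ltr_wpDl//= ltr_pdivrMr// mul1r.
have : ((Q i).+1%:R <= Lr) by rewrite ler_nat -[leqRHS]expn1.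
by rewrite -natr1; apply: lt_le_trans; rewrite ltrD2l.
Qed.

Lemma Psi_cube (Q : idx 1) x : Cube x -> Cube (Psi Q x).
Proof.
move=> ox i; have /andP[x0 x1] := ox i.
rewrite PsiE divr_ge0 ?addr_ge0 ?(ltW L_gt0)//= ler_pdivrMr// mul1r.
have : ((Q i).+1%:R <= Lr) by rewrite ler_nat -[leqRHS]expn1.
by rewrite -natr1; apply: le_trans; rewrite lerD2l.
Qed.

(** The integer parts of the coordinates of L (Psi Q x) determine Q when x is in the
    open cube; the second point may lie on the boundary, as needed to identify the
    cells met by a closed cube. *)
Lemma Psi_separated (Q Q' : idx 1) (x y : V) : open_cube x -> Cube y ->
  Psi Q x = Psi Q' y -> Q = Q'.
Proof.
move=> ox cy /rowP xy; apply/ffunP => i; apply/val_inj => /=.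
have := xy i; rewrite !PsiE => /(mulIf (invr_neq0 L_neq0)) E.
have /andP[x0 x1] := ox i; have /andP[y0 y1] := cy i.
have : (Q i)%:R < (Q' i).+1%:R :> R by rewrite -natr1; lra.
have : (Q' i)%:R < (Q i).+1%:R :> R by rewrite -natr1; lra.
by rewrite !ltr_nat !ltnS => le1 le2; apply/eqP; rewrite eqn_leq le1 le2.
Qed.

Lemma Psi_interior (Q : idx 1) x : open_cube x -> (cube Q)° (Psi Q x).
Proof.
move=> ox; have : \forall y \near Psi Q x, forall i : 'I_d,
    corner Q 0 i <= (y : V) 0 i <= corner Q 0 i + Lr ^- 1.
  apply: (@filter_forall V 'I_d (fun i (y : V) =>
    corner Q 0 i <= y 0 i <= corner Q 0 i + Lr ^- 1) (nbhs (Psi Q x)) _) => i.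
  have /andP[x0 x1] := ox i.
  have lo : corner Q 0 i < (Psi Q x) 0 i.
    by rewrite PsiE /corner !mxE expr1 mulrDl ltrDl divr_gt0.
  have hi : (Psi Q x) 0 i < corner Q 0 i + Lr ^- 1.
    by rewrite PsiE /corner !mxE !expr1 mulrDl ltrD2l gtr_pMl ?invr_gt0.
  have cc : {for Psi Q x, continuous (fun y : V => y 0 i)} by exact: coord_continuous.
  near=> y; apply/andP; split; apply: ltW; near: y.
    exact: (cvgr_gt _ cc).
  exact: (cvgr_lt _ cc).
by [].
Unshelve. all: by end_near. Qed.

Lemma interior_cubeE (Q : idx 1) x : (cube Q)° x -> exists2 y, open_cube y & x = Psi Q y.
Proof.
move=> /nbhs_ballP[e /= e0 eQ]; exists (Psi_inv Q x); last by rewrite Psi_invK.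
have e20 : 0 < e / 2 by rewrite divr_gt0.
have nb (s : R) : `|s| <= e / 2 -> ball x e (x + const_mx s).
  move=> se; rewrite -ball_normE /= opprD addNKr normrN.
  apply: le_lt_trans (_ : _ <= e / 2) _; last by move: e0 => /=; lra.
  by apply: rV_norm_le => [|i]; [exact: ltW|rewrite mxE].
move=> i.
have := eQ _ (nb (e / 2) _) i; have := eQ _ (nb (- (e / 2)) _) i.
rewrite normrN ger0_norm ?(ltW e20)// /corner !mxE !expr1 => /(_ (lexx _))/andP[lo _] /(_ (lexx _))/andP[_ hi].
rewrite subr_gt0 ltrBlDl -ltr_pdivrMl// mulrC.
apply/andP; split; first by lra.
have : x 0 i < ((Q i)%:R + 1) / Lr by rewrite mulrDl mul1r; lra.
by rewrite ltr_pdivlMr// mulrC; lra.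
Qed.

Context (F1 : set V) (hF : is_GSC L F1).
Local Notation S := (cells L 1 F1).
Local Notation Fn := (prefractal L F1).
Local Notation F := (carpet L F1).

(** F_1 is F_0 subdivided once, so that a single recursion covers all levels. *)
Lemma first_level : F1 = subdivide L F1 Cube.
Proof.
have [S' F1E] := gsc_cells hF.
suff SS' : S = S' by rewrite /subdivide SS' {1}F1E; apply: eq_bigcupr => Q _; exact: cubeE.
apply/seteqP; split=> Q.
  move=> [x [/interior_cubeE[y oy ->]]]; rewrite F1E => -[Q' S'Q' ].
  by rewrite cubeE => -[z cz /esym/(Psi_separated oy cz) ->].
move=> S'Q; exists (Psi Q (const_mx 2^-1)); have h : open_cube (const_mx 2^-1).
  by move=> i; rewrite mxE invr_gt0 ltr0n/= invf_lt1// ltr1n.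
split; first exact: Psi_interior.
rewrite F1E; exists Q => //; rewrite cubeE; exists (const_mx 2^-1) => // i.
by have /andP[/ltW-> /ltW->] := h i.
Qed.

Lemma prefractalS n : Fn n.+1 = subdivide L F1 (Fn n).
Proof. by case: n => [|n] //; exact: first_level. Qed.

Lemma subdivideS (A B : set V) : A `<=` B -> subdivide L F1 A `<=` subdivide L F1 B.
Proof. by move=> AB x [Q SQ [y Ay <-]]; exists Q => //; exists y => //; exact: AB. Qed.

Lemma prefractal_decr n : Fn n.+1 `<=` Fn n.
Proof.
elim: n => [|n IH]; last by rewrite (prefractalS n.+1) [X in _ `<=` X]prefractalS; exact: subdivideS.
by move=> x; rewrite prefractalS => -[Q SQ [y Cy <-]]; exact: Psi_cube.
Qed.

Lemma prefractal_le m n : (m <= n)%N -> Fn n `<=` Fn m.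
Proof.
by move=> /subnKC <-; elim: (n - m)%N => [|k IH]; rewrite ?addn0// addnS => x /prefractal_decr/IH.
Qed.

Lemma carpet_Psi (Q : idx 1) x : S Q -> F x -> F (Psi Q x).
Proof.
move=> SQ Fx n _; case: n => [|n]; first by apply: Psi_cube; exact: (Fx 0%N I).
by rewrite prefractalS; exists Q => //; exists x => //; exact: Fx.
Qed.

(** If x were in no Psi Q (F), each Q would have a level at which it fails, and x
    could not be in a prefractal beyond the maximum of these finitely many levels. *)
Lemma carpet_subdivide : F `<=` subdivide L F1 F.
Proof.
move=> x Fx; apply: contrapT => nx.
have bad (Q : idx 1) : exists n, S Q -> ~ Fn n (Psi_inv Q x).
  apply: contrapT => nbad; apply: nx; exists Q.
    by apply: contrapT => nS; apply: nbad; exists 0%N.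
  exists (Psi_inv Q x); last exact: Psi_invK.
  by move=> n _; apply: contrapT => nF; apply: nbad; exists n.
have [N hN] := choice bad.
have : Fn (\max_(Q : idx 1) N Q).+1 x by exact: Fx.
rewrite prefractalS => -[Q SQ [y Fy yx]].
apply: (hN Q SQ); rewrite (_ : Psi_inv Q x = y).
  by apply: prefractal_le Fy; exact: leq_bigmax.
by apply: (@Psi_inj Q); rewrite Psi_invK.
Qed.

Let L_gt0' : (0 < L ^ 1)%N. Proof. by rewrite expn1 (leq_trans _ hL). Qed.
Let last_lt : (L.-1 < L ^ 1)%N. Proof. by rewrite expn1 prednK// (leq_trans _ hL). Qed.
Let Q0 : idx 1 := [ffun _ => Ordinal L_gt0'].
Let Qlast : idx 1 := [ffun _ => Ordinal last_lt].

Let SQ0 : S Q0.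
Proof.
have [Q SQ [y Cy Qy]] : subdivide L F1 Cube (0 : V).
  rewrite -first_level.
  by apply: (gsc_borders hF); split=> [i|i _]; rewrite mxE// lexx ler01.
suff <- : Q = Q0 by [].
apply/ffunP => i; apply/val_inj; rewrite ffunE /=.
have /rowP/(_ i) := Qy; rewrite PsiE mxE => /eqP.
rewrite mulf_eq0 invr_eq0 (negbTE L_neq0) orbF => /eqP E.
have /andP[y0 _] := Cy i.
have : (Q i)%:R <= 0 :> R by rewrite -E lerDl.
by rewrite lern0 => /eqP.
Qed.

Let SQlast : S Qlast.
Proof.
pose Phi (x : V) := one - x.
have PhiC x : Cube x -> Cube (Phi x).
  by move=> Cx i; have /andP[? ?] := Cx i; rewrite !mxE; apply/andP; split; lra.
have PhiK x : Phi (Phi x) = x by rewrite /Phi opprB addrC subrK.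
have F10 : F1 (0 : V).
  by apply: (gsc_borders hF); split=> [i|i _]; rewrite mxE// lexx ler01.
have : (Phi @` F1) one by exists 0 => //; rewrite /Phi subr0.
rewrite (gsc_symmetric hF) => [F11||]; last 2 first.
- move=> x y _ _; rewrite /enorm; congr Num.sqrt; apply: eq_bigr => i _.
  by rewrite !mxE; ring.
- apply/seteqP; split=> [_ [x Cx <-]|x Cx]; first exact: PhiC.
  by exists (Phi x); [exact: PhiC|exact: PhiK].
have [Q SQ [y Cy Qy]] : subdivide L F1 Cube one by rewrite -first_level.
suff <- : Q = Qlast by [].
apply/ffunP => i; apply/val_inj; rewrite ffunE /=.
have /rowP/(_ i) := Qy; rewrite PsiE mxE => /(congr1 ( *%R^~ Lr)).
rewrite divfK// mul1r => E; have /andP[_ y1] := Cy i.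
have QL : (Q i < L)%N by rewrite -[ltnRHS]expn1.
have : Lr <= (Q i).+1%:R by rewrite -natr1; lra.
rewrite ler_nat => LQ; apply/eqP; rewrite -eqSS prednK ?(leq_trans _ hL)//.
by rewrite eqn_leq QL LQ.
Qed.

Let carpet_one : F one.
Proof.
have C1 : Cube one by move=> i; rewrite mxE ler01 lexx.
have PQ : Psi Qlast one = one.
  have L0 : (0 < L)%N by exact: leq_trans _ hL.
  by apply/rowP => i; rewrite PsiE ffunE !mxE /= natr1 (prednK L0) divff.
move=> n _; elim: n => [//|n IH]; rewrite prefractalS.
by exists Qlast => //; exists one.
Qed.

(** Each cell of F_1 has a point of F in its interior: the far corner of the first
    subcell of the corner cell at 0 is in F and in the open unit cube.  The corners 0
    and (1, ..., 1) are in F_1 by the border condition and the reflection symmetry.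
    Hence hausdorff_dim counts exactly the cells of F_1. *)
Lemma cells_carpet : cells L 1 F = S.
Proof.
apply/seteqP; split=> Q.
  by move=> [x [ix Fx]]; exists x; split=> //; exact: (Fx 1%N I).
move=> SQ; have op : open_cube (Psi Q0 one).
  move=> i; rewrite PsiE ffunE !mxE /= add0r divr_gt0//= ltr_pdivrMr// mul1r.
  by rewrite ltr1n (leq_trans _ hL).
exists (Psi Q (Psi Q0 one)); split; first exact: Psi_interior.
by apply: carpet_Psi => //; exact: carpet_Psi.
Qed.

Lemma Psi_continuous (Q : idx 1) : continuous (@Psi R d L 1 Q).
Proof.
move=> x; apply: (@continuousD _ _ V (fun=> corner Q) (fun x : V => Lr ^- 1 *: x)).
  exact: cst_continuous.
exact: scaler_continuous.
Qed.

Lemma compact_Psi (Q : idx 1) (A : set V) : compact A -> compact (Psi Q @` A).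
Proof.
by apply: continuous_compact; apply: continuous_subspaceT; exact: Psi_continuous.
Qed.

Lemma prefractal_compact n : compact (Fn n).
Proof.
elim: n => [|n IH]; first exact: unit_cube_compact.
rewrite prefractalS /subdivide -[S]set_mem_set bigcup_pred.
by apply: bigsetU_compact => Q _; exact: compact_Psi.
Qed.

Lemma carpet_compact : compact F.
Proof.
apply: (@subclosed_compact _ _ Cube); last by move=> x Fx; exact: (Fx 0%N I).
  apply: closed_bigI => n _.
  by apply: compact_closed; [exact: norm_hausdorff|exact: prefractal_compact].
exact: unit_cube_compact.
Qed.

End CarpetGeometry.

(** * Integrals against measures bounded on a finite cover *)

Section CoverIntegral.
Context {R : realType} {d : nat}.
Local Notation V := 'rV[R]_d.

(** On K the function v is at most the sum of the b i over the sets A i containing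
    the point; overlaps only help because the b i are nonnegative. *)
Lemma cover_integral_le (nu : probability V R) (K : set V) (I : finType) (A : I -> set V)
    (b : I -> R) (p : R) (v : V -> R) :
  measurable K -> (forall i, measurable (A i)) -> K `<=` \bigcup_i A i ->
  (forall i, 0 <= b i) -> (forall i, (nu (A i) <= p%:E)%E) ->
  nu.-integrable K (EFin \o v) -> (forall i x, K x -> A i x -> v x <= b i) ->
  \int[nu]_(x in K) v x <= \sum_i b i * p.
Proof.
move=> mK mA KA b0 Ap Iv vb.
have mb i : measurable_fun K (fun x => (b i * \1_(A i) x)%:E).
  by apply/measurable_EFinP; apply: measurable_funM => //; exact: measurable_indic.
have b1 i x : (0 <= (b i * \1_(A i) x)%:E)%E by rewrite lee_fin mulr_ge0.
have le : (\int[nu]_(x in K) (v x)%:E <= \int[nu]_(x in K) (\sum_(i <- index_enum I) (b i * \1_(A i) x)%:E)%R)%E.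
  have fin_ind i : nu.-integrable K (fun x => (b i * \1_(A i) x)%:E).
    apply: (@le_integrable _ _ _ nu _ _ _ (EFin \o cst (b i))) => //.
      move=> x _ /=; rewrite lee_fin !ger0_norm ?mulr_ge0//.
      by rewrite ler_piMr// indicE lern1; case: (_ \in _).
    exact: finite_measure_integrable_cst.
  apply: le_integral => //.
    by apply: integrable_sum.
  move=> x /set_mem Kx; rewrite /= sumEFin lee_fin.
  have [i _ Aix] := KA _ Kx.
  rewrite (bigD1 i)//= indicE mem_set// mulr1 (le_trans (vb _ _ Kx Aix))// lerDl.
  by apply: sumr_ge0 => j _; rewrite mulr_ge0.
rewrite -lee_fin {1}/Rintegral fineK; last exact: integrable_fin_num.
apply: le_trans le _; rewrite ge0_integral_sum// -sumEFin; apply: lee_sum => i _.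
rewrite (@integralZl_indic _ _ _ _ _ mK (fun=> A i))//; last first.
  by move=> bi; move: (b0 i); rewrite leNgt bi.
rewrite integral_indic// EFinM lee_wpmul2l// ?lee_fin//.
apply: le_trans (Ap i); apply: le_measure; rewrite ?inE//.
exact: measurableI.
Qed.

(** The upper bound applied to v + M and to M - v.  As the #|I| sets cover a set of
    mass 1, bounding each mass by 1 / #|I| loses nothing, and no separate lower bound on
    the masses enters. *)
Lemma cover_integral_average (nu : probability V R) (K : set V) (I : finType)
    (A : I -> set V) (b : I -> R) (e : R) (v : V -> R) :
  measurable K -> nu K = 1%E ->
  (forall i, measurable (A i)) -> K `<=` \bigcup_i A i -> (0 < #|I|)%N ->
  (forall i, (nu (A i) <= (#|I|%:R^-1)%:E)%E) ->
  measurable_fun K v -> (exists2 M : R, 0 < M & forall x, `|v x| <= M) ->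
  (forall i, exists y, b i = v y) ->
  (forall i x, K x -> A i x -> `|v x - b i| <= e) ->
  `|\int[nu]_(x in K) v x - (\sum_i b i) / #|I|%:R| <= e.
Proof.
move=> mK nuK mA KA I0 Ap mv [M M0 vM] bv vb.
have N0 : #|I|%:R != 0 :> R by rewrite pnatr_eq0 -lt0n.
have e0 : 0 <= e \/ K = set0.
  have [->|/set0P[x Kx]] := eqVneq K set0; first by right.
  by left; have [i _ Ax] := KA _ Kx; apply: le_trans (vb _ _ Kx Ax).
case: e0 => [e0|K0]; last by move: nuK; rewrite K0 measure0 => -[] /eqP; rewrite eq_sym oner_eq0.
have bM i : `|b i| <= M by have [y ->] := bv i.
have Ic (c : R) : nu.-integrable K (EFin \o (fun=> c)) by exact: finite_measure_integrable_cst.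
have Iv : nu.-integrable K (EFin \o v).
  apply: le_integrable (Ic M) => //; first exact/measurable_EFinP.
  by move=> x _ /=; rewrite lee_fin (ger0_norm (ltW M0)).
have cst1 (c : R) : \int[nu]_(x in K) c = c.
  transitivity (c * fine (nu K)); first exact: Rintegral_cst.
  by rewrite nuK mulr1.
have sumc (c : R) : \sum_(i : I) c * #|I|%:R^-1 = c.
  by rewrite sumr_const -[LHS]mulr_natr divfK.
have up : \int[nu]_(x in K) (v x + M) <= \sum_i (b i + e + M) * #|I|%:R^-1.
  apply: (cover_integral_le (A := A)) => // [i||i x Kx Ax].
  - by have := bM i; rewrite ler_norml; lra.
  - have := integrableD mK Iv (Ic M); exact: eq_integrable.
  - by have := vb i x Kx Ax; rewrite ler_norml; lra.
have lo : \int[nu]_(x in K) (M - v x) <= \sum_i (M - b i + e) * #|I|%:R^-1.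
  apply: (cover_integral_le (A := A)) => // [i||i x Kx Ax].
  - by have := bM i; rewrite ler_norml; lra.
  - have := integrableB mK (Ic M) Iv; exact: eq_integrable.
  - by have := vb i x Kx Ax; rewrite ler_norml; lra.
rewrite RintegralD// cst1 in up; rewrite RintegralB// cst1 in lo.
have E1 : \sum_i (b i + e + M) * #|I|%:R^-1 = (\sum_i b i) / #|I|%:R + (e + M).
  by rewrite mulr_suml -[X in _ + X]sumc -big_split/=; apply: eq_bigr => i _; rewrite -mulrDl addrA.
have E2 : \sum_i (M - b i + e) * #|I|%:R^-1 = (M + e) - (\sum_i b i) / #|I|%:R.
  by rewrite mulr_suml -[X in X - _]sumc -sumrB/=; apply: eq_bigr => i _; rewrite -mulrBl addrAC.
by rewrite ler_norml; rewrite E1 in up; rewrite E2 in lo; apply/andP; split; lra.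
Qed.
End CoverIntegral.

(** * Hausdorff measure under similarities *)

Section Hausdorff.
Context {R : realType} {d : nat}.
Local Notation V := 'rV[R]_d.

Lemma ediam_ge0 (A : set V) : (0 <= ediam A)%E.
Proof. by rewrite /ediam le_max lexx. Qed.

Lemma hausdorff_measureS (s : R) (A B : set V) : A `<=` B ->
  (hausdorff_measure s A <= hausdorff_measure s B)%E.
Proof.
move=> AB; apply: ge_ereal_sup => _ [del /= del0 <-].
apply: le_trans (ereal_sup_ubound _); last by exists del.
by apply: le_ereal_inf => _ [U [BU Ud] <-]; exists U => //; split=> // x /AB/BU.
Qed.

Variables (r : R) (c : V).
Hypothesis r_gt0 : 0 < r.
Let f (x : V) := c + r *: x.

Lemma ediam_similarity_le (A : set V) : (ediam (f @` A) <= r%:E * ediam A)%E.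
Proof.
rewrite {1}/ediam ge_max mule_ge0 ?ediam_ge0 ?lee_fin ?(ltW r_gt0)//=.
apply: ge_ereal_sup => _ [[_ _] [[x Ax <-] [y Ay <-]] <-] /=.
have -> : enorm (f x - f y) = r * enorm (x - y).
  rewrite /enorm -[X in X * _](ger0_norm (ltW r_gt0)) -sqrtr_sqr -sqrtrM ?sqr_ge0//.
  congr Num.sqrt; rewrite mulr_sumr; apply: eq_bigr => i _.
  by rewrite !mxE; ring.
rewrite EFinM lee_wpmul2l// ?lee_fin ?(ltW r_gt0)//.
by rewrite /ediam le_max; apply/orP; right; apply: ereal_sup_ubound; exists (x, y).
Qed.

(** The image of a cover is a cover by sets with diameters multiplied by r. *)
Lemma hausdorff_measure_similarity_le (s : R) (A : set V) : 0 <= s ->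
  (hausdorff_measure s (f @` A) <= (r `^ s)%:E * hausdorff_measure s A)%E.
Proof.
move=> s0; have q0 : 0 < r `^ s by rewrite powR_gt0.
apply: ge_ereal_sup => _ [del /= del0 <-].
have del'0 : 0 < r^-1 * del by rewrite mulr_gt0 ?invr_gt0.
apply: (@le_trans _ _ ((r `^ s)%:E * hausdorff_content s (r^-1 * del) A)%E); last first.
  by rewrite lee_pmul2l ?lte_fin//; apply: ereal_sup_ubound; exists (r^-1 * del).
rewrite -lee_pdivrMl//; apply: le_ereal_inf_tmp => _ [U [AU Ud] <-].
rewrite lee_pdivrMl//.
apply: (@le_trans _ _ (\sum_(0 <= k <oo) ediam (f @` U k) `^ s)%E).
  apply: ereal_inf_lbound; exists (fun k => f @` U k) => //; split=> [_ [x Ax <-]|k].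
    by have [k _ Ux] := AU _ Ax; exists k => //; exists x.
  apply: le_trans (ediam_similarity_le _) _.
  have := lee_wpmul2l (ltW (_ : (0 < r%:E)%E)) (Ud k); rewrite lte_fin => /(_ r_gt0).
  by rewrite -EFinM mulrA divff ?gt_eqF// mul1r.
rewrite -nneseriesZl; last by move=> k _; exact: poweR_ge0.
apply: lee_nneseries => [k _ _|k _]; first exact: poweR_ge0.
rewrite -poweR_EFin -poweRM ?ediam_ge0 ?lee_fin ?(ltW r_gt0)//.
apply: (gt0_ler_poweR s0); rewrite ?in_itv /= ?leey ?andbT ?ediam_ge0//.
  by rewrite mule_ge0 ?ediam_ge0 ?lee_fin ?(ltW r_gt0).
exact: ediam_similarity_le.
Qed.

End Hausdorff.

(** * Cells of level n, coded by words *)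

Lemma dist_unit_le1 (R : realFieldType) (a b : R) :
  0 <= a <= 1 -> 0 <= b <= 1 -> `|a - b| <= 1.
Proof.
by move=> /andP[a0 a1] /andP[b0 b1]; rewrite ler_norml; apply/andP; split; lra.
Qed.

Section Words.
Context {R : realType} {d L : nat}.
Local Notation V := 'rV[R]_d.
Local Notation idx n := {ffun 'I_d -> 'I_(L ^ n)}.
Local Notation Lr := (L%:R : R).
Local Notation Cube := (@unit_cube R d).
Hypothesis hL : (3 <= L)%N.
Context (F1 : set V) (hF : is_GSC L F1).
Local Notation S := (cells L 1 F1).
Local Notation Fn := (prefractal L F1).
Local Notation F := (carpet L F1).

Definition letter := {Q : idx 1 | Q \in S}.

Definition word_map (w : seq letter) (x : V) : V :=
  foldr (fun Q y => Psi (val Q) y) x w.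

Let L_gt0 : 0 < Lr. Proof. by rewrite ltr0n (leq_trans _ hL). Qed.

Lemma letterP (Q : letter) : S (val Q).
Proof. by apply/set_mem; exact: (valP Q). Qed.

Lemma card_letter : #|{: letter}| = ncopies L F1.
Proof.
rewrite card_sig /ncopies /ncells; apply: eq_card => Q.
by rewrite !inE (cells_carpet hL hF).
Qed.

Lemma ncopies_gt0 : (0 < ncopies L F1)%N.
Proof.
rewrite -card_letter; apply/card_gt0P.
have [Q SQ _] : (subdivide L F1 (Fn 0%N)) 0.
  rewrite -(prefractalS hL hF); apply: (gsc_borders hF).
  by split=> [i|i _]; rewrite mxE// lexx ler01.
by exists (exist _ Q (mem_set SQ)).
Qed.

Lemma word_mapE (w : seq letter) (x : V) i :
  word_map w x 0 i = word_map w 0 0 i + x 0 i / Lr ^+ size w.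
Proof.
elim: w => [|Q w IH] /=; first by rewrite mxE add0r divr1.
rewrite !(PsiE (L := L)) IH exprS invfM; ring.
Qed.

Lemma word_map_similarity (w : seq letter) :
  word_map w = (fun x => word_map w 0 + (Lr ^+ size w)^-1 *: x).
Proof.
by apply/funext => x; apply/rowP => i; rewrite word_mapE !mxE [_^-1 * _]mulrC.
Qed.

Lemma word_cover (A : nat -> set V) : (forall n, A n.+1 `<=` subdivide L F1 (A n)) ->
  forall n, A n `<=` \bigcup_(w : n.-tuple letter) (word_map w @` A 0%N).
Proof.
move=> hA; elim=> [|n IH] x; first by exists [tuple] => //; exists x.
move=> /hA[Q SQ [y /IH[w _ [z A0z <-]] <-]].
by exists [tuple of (exist _ Q (mem_set SQ) : letter) :: w] => //; exists z.
Qed.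

Lemma word_prefractal n : Fn n = \bigcup_(w : n.-tuple letter) (word_map w @` Cube).
Proof.
apply/seteqP; split.
  by apply: (word_cover (A := Fn)) => k; rewrite (prefractalS hL hF).
elim: n => [|n IH] x [w _ [y Cy <-]]; first by rewrite tuple0.
rewrite (prefractalS hL hF); case/tupleP: w => Q w /=; exists (val Q); first exact: letterP.
by exists (word_map w y) => //; apply: IH; exists w => //; exists y.
Qed.

Lemma word_carpet n : F `<=` \bigcup_(w : n.-tuple letter) (word_map w @` F).
Proof.
by apply: (word_cover (A := fun=> F)) => _; exact: (carpet_subdivide hL hF).
Qed.

Lemma word_map_cube w x : Cube x -> Cube (word_map w x).
Proof. by move=> Cx; elim: w => //= Q w; exact: (Psi_cube hL). Qed.

Lemma word_map_open_cube w x : open_cube x -> open_cube (word_map w x).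
Proof. by move=> Cx; elim: w => //= Q w; exact: (Psi_open_cube hL). Qed.

(** A word is read off from a point of its open cell, letter by letter. *)
Lemma word_map_separated n (w w' : n.-tuple letter) x y : open_cube x -> open_cube y ->
  word_map w x = word_map w' y -> w = w'.
Proof.
move=> ox oy; elim: n w w' => [|n IH] w w'; first by rewrite (tuple0 w) (tuple0 w').
case/tupleP: w => Q w; case/tupleP: w' => Q' w' /= E.
have oc : Cube (word_map w' y).
  by move=> i; have /andP[/ltW-> /ltW->] := word_map_open_cube w' oy i.
have QQ := Psi_separated hL (word_map_open_cube w ox) oc E.
move: E; rewrite QQ => /(Psi_inj hL)/IH ->.
by congr [tuple of _ :: _]; apply: val_inj.
Qed.

Lemma word_map_diam w x y : Cube x -> Cube y ->
  `|word_map w x - word_map w y| <= (Lr ^+ size w)^-1.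
Proof.
move=> Cx Cy; have p0 : 0 <= (Lr ^+ size w)^-1 by rewrite invr_ge0 exprn_ge0// ltW.
apply: rV_norm_le => // i; rewrite !mxE (word_mapE w x) (word_mapE w y).
rewrite opprD addrACA subrr add0r -mulrBl normrM (ger0_norm p0) ler_piMl//.
exact: dist_unit_le1.
Qed.

Lemma compact_word_map w (A : set V) : compact A -> compact (word_map w @` A).
Proof.
move=> cA; elim: w => [|Q w IH]; first by rewrite (_ : [set _ | _ in _] = A)// image_id.
by rewrite -(image_comp (word_map w) (Psi (val Q))); exact: compact_Psi.
Qed.

Lemma continuous_uniform_cube (v : V -> R) : continuous v -> forall e : R, 0 < e ->
  \forall m \near \oo, forall x y, Cube x -> Cube y ->
    `|x - y| <= (Lr ^+ m)^-1 -> `|v x - v y| < e.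
Proof.
move=> cv e e0; have e20 : 0 < e / 2 by rewrite divr_gt0.
suff : \forall m \near \oo, Cube `<=` [set x | forall y, Cube y ->
    `|x - y| <= (Lr ^+ m)^-1 -> `|v x - v y| < e].
  by apply: filterS => m h x y Cx Cy; exact: h.
apply: ((compact_near_coveringP _).1 unit_cube_compact) => x Cx.
have /cvgrPdist_lt/(_ _ e20)/nbhs_ballP[del /= del0 hdel] := cv x.
have del20 : 0 < del / 2 by rewrite divr_gt0.
have pw : \forall m \near \oo, (Lr ^+ m)^-1 < del / 2.
  have L1 : `|Lr^-1| < 1.
    by rewrite ger0_norm ?invr_ge0 ?(ltW L_gt0)// invf_lt1// ltr1n (leq_trans _ hL).
  have /cvgrPdist_lt/(_ _ del20) := cvg_geometric 1 L1.
  apply: filterS => m; rewrite /geometric /= mul1r sub0r normrN exprVn ger0_norm//.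
have zx : \forall z \near x, `|x - z| < del / 2.
  by apply/nbhs_ballP; exists (del / 2) => // z; rewrite -ball_normE.
near=> z m => /= y Cy zy.
have xz : `|x - z| < del / 2 by near: z.
have pm : (Lr ^+ m)^-1 < del / 2 by near: m.
have vz : `|v x - v z| < e / 2.
  by apply: hdel; rewrite -ball_normE /=; lra.
have vy : `|v x - v y| < e / 2.
  apply: hdel; rewrite -ball_normE /= -[x - y](subrKA z).
  rewrite (le_lt_trans (ler_normD _ _))//; lra.
rewrite -[v z - v y](subrKA (v x)) (le_lt_trans (ler_normD _ _))// [`|v z - v x|]distrC; lra.
Unshelve. all: by end_near. Qed.

End Words.

(** * Masses of the cells *)

Section LebesgueBoxes.
Context {R : realType} {d : nat}.
Local Notation V := 'rV[R]_d.
Context (lam : {measure set V -> \bar R}) (hlam : is_lebesgue lam).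

Definition box (a b : V) : set V := [set x | forall i, a 0 i <= x 0 i <= b 0 i].

Lemma box_measurable a b : measurable (box a b).
Proof.
apply: closed_measurable_rV; apply: compact_closed; first exact: norm_hausdorff.
have -> : box a b = [set v | forall i, `[a 0 i, b 0 i]%classic (v ord0 i)].
  by apply/seteqP; split=> x /= h i; have := h i; rewrite in_itv.
by apply: (@rV_compact R d (fun i => `[a 0 i, b 0 i]%classic)) => i; exact: segment_compact.
Qed.

Lemma bigsetU_null (I : Type) (s : seq I) (A : I -> set V) :
  (forall i, measurable (A i)) -> (forall i, lam (A i) = 0%E) ->
  lam (\big[setU/set0]_(i <- s) A i) = 0%E.
Proof.
move=> mA A0; elim: s => [|i s IH]; first by rewrite big_nil measure0.
by rewrite big_cons setUC measureU0// ?A0//; exact: bigsetU_measurable.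
Qed.

Definition face (a b : V) (k : 'I_d * bool) : set V :=
  box (\row_j if (j == k.1) && k.2 then b 0 j else a 0 j)
      (\row_j if (j == k.1) && ~~ k.2 then a 0 j else b 0 j).

Lemma face_null (a b : V) k : (forall i, a 0 i <= b 0 i) -> lam (face a b k) = 0%E.
Proof.
move=> ab; rewrite hlam => [|i].
  congr EFin; rewrite (bigD1 k.1)//= !mxE eqxx /=.
  by case: k.2; rewrite /= subrr mul0r.
by rewrite !mxE; case: (i == k.1); case: k.2 => //=.
Qed.

(** A measurable substitute for the open box: the closed box without its faces. *)
Definition slit_box a b := box a b `\` \big[setU/set0]_k face a b k.

Lemma slit_box_measurable a b : measurable (slit_box a b).
Proof.
apply: measurableD; first exact: box_measurable.
by apply: bigsetU_measurable => k _; exact: box_measurable.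
Qed.

Lemma lebesgue_slit_box (a b : V) : (forall i, a 0 i <= b 0 i) ->
  lam (slit_box a b) = (\prod_i (b 0 i - a 0 i))%:E.
Proof.
move=> ab; rewrite -hlam//.
have mf : measurable (\big[setU/set0]_k face a b k).
  by apply: bigsetU_measurable => k _; exact: box_measurable.
have f0 : lam (\big[setU/set0]_k face a b k) = 0%E.
  by apply: bigsetU_null => k; [exact: box_measurable|exact: face_null].
rewrite -(measureU0 (slit_box_measurable a b) mf f0).
apply/eqP; rewrite eq_le; apply/andP; split; apply: le_measure; rewrite ?inE.
- by apply: measurableU => //; exact: slit_box_measurable.
- exact: box_measurable.
- rewrite subUset; split; first by move=> x [].
  rewrite -bigcup_seq => x [k _ fx] i; have /andP[] := fx i; rewrite !mxE.
  by move=> lo hi; apply/andP; split; [apply: le_trans lo|apply: le_trans hi _];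
    case: ifP => // _; exact: ab.
- exact: box_measurable.
- by apply: measurableU => //; exact: slit_box_measurable.
by move=> x bx; have [|] := pselect ((\big[setU/set0]_k face a b k) x); [right|left].
Qed.

Lemma slit_box_interior (a b x : V) : slit_box a b x -> forall i, a 0 i < x 0 i < b 0 i.
Proof.
move=> [bx nx] i; have /andP[ai ib] := bx i; rewrite !lt_neqAle ai ib !andbT.
apply/andP; split; apply/negP => /eqP E; apply: nx; rewrite -bigcup_seq.
  exists (i, false); first exact: mem_index_enum.
  move=> j; rewrite !mxE /= andbF andbT; have /andP[aj jb] := bx j.
  by rewrite aj /=; case: eqP => [->|//]; rewrite E.
exists (i, true); first exact: mem_index_enum.
move=> j; rewrite !mxE /= andbF andbT; have /andP[aj jb] := bx j.
by rewrite jb andbT; case: eqP => [->|//]; rewrite E.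
Qed.

End LebesgueBoxes.

Section CellMeasures.
Context {R : realType} {d L : nat}.
Local Notation V := 'rV[R]_d.
Local Notation Lr := (L%:R : R).
Local Notation Cube := (@unit_cube R d).
Hypothesis hL : (3 <= L)%N.
Context (F1 : set V) (hF : is_GSC L F1).
Local Notation Fn := (prefractal L F1).
Local Notation F := (carpet L F1).
Local Notation N := (ncopies L F1).
Local Notation letter := (letter (L := L) F1).

Let L_gt0 : 0 < Lr. Proof. by rewrite ltr0n (leq_trans _ hL). Qed.
Let N_gt0 : 0 < N%:R :> R. Proof. by rewrite ltr0n (ncopies_gt0 hL hF). Qed.

Lemma closed_prefractal n : closed (Fn n).
Proof. by apply: compact_closed; [exact: norm_hausdorff|exact: (@prefractal_compact _ _ _ hL _ hF n)]. Qed.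

Lemma closed_carpet : closed F.
Proof. by apply: compact_closed; [exact: norm_hausdorff|exact: (@carpet_compact _ _ _ hL _ hF)]. Qed.

Lemma measurable_prefractal n : measurable (Fn n).
Proof. by apply: closed_measurable_rV; exact: closed_prefractal. Qed.

Lemma measurable_carpet : measurable F.
Proof. by apply: closed_measurable_rV; exact: closed_carpet. Qed.

Lemma measurable_word_map w (A : set V) : compact A -> measurable (word_map (F1 := F1) (L := L) w @` A).
Proof.
move=> cA; apply: closed_measurable_rV; apply: compact_closed; first exact: norm_hausdorff.
exact: (compact_word_map cA).
Qed.

Lemma card_words n : #|{: n.-tuple letter}| = (N ^ n)%N.
Proof. by rewrite card_tuple (card_letter hL hF). Qed.

Lemma normalized_full nu (K : set V) (m : probability V R) :
  measurable K -> normalized_restriction nu K m -> m K = 1%E.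
Proof.
move=> mK [c c0 mE]; rewrite mE// setIid -[in LHS](setTI K) -mE//.
exact: probability_setT.
Qed.

(** The dimension is the exponent for which scaling by 1 / L divides measure by the
    number of cells. *)
Lemma hausdorff_dim_scaling n : ((Lr ^+ n)^-1) `^ hausdorff_dim L F1 = (N%:R ^+ n)^-1.
Proof.
have lnL : 0 < ln Lr by rewrite ln_gt0// ltr1n (leq_trans _ hL).
have Ln0 : 0 < Lr ^+ n by rewrite exprn_gt0.
rewrite /powR gt_eqF ?invr_gt0// lnV ?posrE// lnXn// /hausdorff_dim.
rewrite mulrN mulrnAr divfK ?gt_eqF// -lnXn//.
by rewrite expRN lnK// posrE exprn_gt0.
Qed.

(** Self-similarity: a cell of level n is a copy of F scaled by L^-n. *)
Lemma carpet_cell_measure_le (mu : probability V R) :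
  normalized_restriction (hausdorff_measure (hausdorff_dim L F1)) F mu ->
  forall n (w : n.-tuple letter), (mu (word_map w @` F) <= (#|{: n.-tuple letter}|%:R^-1)%:E)%E.
Proof.
move=> hmu n w; have muF := normalized_full measurable_carpet hmu.
case: hmu => c c0 muE; have cF := @carpet_compact _ _ _ hL _ hF.
have s0 : 0 <= hausdorff_dim L F1.
  by rewrite divr_ge0// ln_ge0// ler1n ?(ncopies_gt0 hL hF)// (leq_trans _ hL).
rewrite muE; last exact: measurable_word_map.
apply: (@le_trans _ _ (c%:E * hausdorff_measure (hausdorff_dim L F1) (word_map w @` F))%E).
  by rewrite lee_pmul2l ?lte_fin//; apply: hausdorff_measureS; exact: subIsetl.
apply: (@le_trans _ _ (c%:E * ((N%:R ^+ n)^-1%:E * hausdorff_measure (hausdorff_dim L F1) F))%E).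
  rewrite lee_pmul2l ?lte_fin// -hausdorff_dim_scaling.
  rewrite (word_map_similarity (F1 := F1)) size_tuple.
  by apply: hausdorff_measure_similarity_le => //; rewrite invr_gt0 exprn_gt0.
rewrite muleCA; have := muE F measurable_carpet; rewrite setIid => <-.
by rewrite muF mule1 card_words natrX.
Qed.

(** All cells have the same volume, also without their faces, and the cells without
    faces are disjoint in a space of total mass 1. *)
Lemma prefractal_cell_measure_le (lam : {measure set V -> \bar R}) (hlam : is_lebesgue lam)
    n (m : probability V R) : normalized_restriction lam (Fn n) m ->
  forall w : n.-tuple letter, (m (word_map w @` Cube) <= (#|{: n.-tuple letter}|%:R^-1)%:E)%E.
Proof.
move=> [c c0 mE] w; have cC := @unit_cube_compact R d.
pose lo (u : n.-tuple letter) : V := word_map u 0.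
pose hi (u : n.-tuple letter) : V := lo u + const_mx (Lr ^+ n)^-1.
have r0 : 0 < (Lr ^+ n)^-1 by rewrite invr_gt0 exprn_gt0.
have lohi u i : lo u 0 i <= hi u 0 i by rewrite /hi !mxE lerDl ltW.
have boxE (u : n.-tuple letter) : word_map u @` Cube = box (lo u) (hi u).
  apply/seteqP; split=> x.
    move=> [y Cy <-] i; have /andP[y0 y1] := Cy i.
    rewrite /hi !mxE (word_mapE (F1 := F1) u y) size_tuple lerDl mulr_ge0 ?(ltW r0)//=.
    by rewrite lerD2l ler_piMl// ltW.
  move=> bx; exists (Lr ^+ n *: (x - lo u)).
    move=> i; have /andP[x0 x1] := bx i; rewrite !mxE.
    rewrite mulr_ge0 ?exprn_ge0 ?(ltW L_gt0) ?subr_ge0//=.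
    by rewrite -ler_pdivlMl ?exprn_gt0// mulr1 lerBlDl; move: x1; rewrite /hi !mxE.
  apply/rowP => i; rewrite (word_mapE (F1 := F1)) size_tuple !mxE mulrAC divff ?mul1r.
    by rewrite /lo addrCA subrr addr0.
  by rewrite expf_neq0// gt_eqF.
pose p := c * (Lr ^+ n)^-1 ^+ d.
have pE (u : n.-tuple letter) : (\prod_i (hi u 0 i - lo u 0 i))%:E = ((Lr ^+ n)^-1 ^+ d)%:E :> \bar R.
  congr EFin; transitivity (\prod_(i < d) (Lr ^+ n)^-1); last by rewrite prodr_const card_ord.
  by apply: eq_bigr => i _; rewrite /hi !mxE addrAC subrr add0r.
have sub (u : n.-tuple letter) : box (lo u) (hi u) `<=` Fn n.
  by rewrite -boxE (word_prefractal hL hF) => x ?; exists u.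
have mbox (u : n.-tuple letter) : m (box (lo u) (hi u)) = p%:E.
  rewrite mE; last exact: box_measurable.
  by rewrite (setIidl (sub u)) hlam// pE.
have mslit (u : n.-tuple letter) : m (slit_box (lo u) (hi u)) = p%:E.
  rewrite mE; last exact: slit_box_measurable.
  rewrite (setIidl (subset_trans _ (sub u))); last by move=> x [].
  by rewrite (lebesgue_slit_box hlam)// pE.
rewrite boxE mbox lee_fin.
have slitE (u : n.-tuple letter) x : slit_box (lo u) (hi u) x -> exists2 y, open_cube y & x = word_map u y.
  move=> sx; have := slit_box_interior sx; case: sx => bx _ ix.
  have : (word_map u @` Cube) x by rewrite boxE.
  move=> [y _ yx]; exists y => // i; have := ix i.
  rewrite /hi -yx !mxE (word_mapE (F1 := F1) u y) size_tuple.
  by rewrite ltrDl ltrD2l pmulr_lgt0// gtr_pMl.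
have triv : trivIset [set: n.-tuple letter] (fun u => slit_box (lo u) (hi u)).
  apply/trivIsetP => u u' _ _ uu'; apply/seteqP; split=> // x [/slitE[y oy xy] /slitE[y' oy' xy']].
  by case/eqP: uu'; apply: (word_map_separated hL oy oy'); rewrite -xy.
have enumE : [set: n.-tuple letter] = [set` enum {: n.-tuple letter}].
  by apply/seteqP; split=> u //= _; rewrite mem_enum.
have fin : finite_set [set: n.-tuple letter] by rewrite enumE; exact: finite_seq.
have : (m (\bigcup_(u in [set: n.-tuple letter]) slit_box (lo u) (hi u)) <= 1)%E.
  apply: probability_le1; apply: fin_bigcup_measurable => // u _.
  exact: slit_box_measurable.
rewrite measure_fin_bigcup//; last by move=> u _; exact: slit_box_measurable.
rewrite enumE.
rewrite -fsbig_seq ?enum_uniq// big_enum /=; under eq_bigr do rewrite mslit.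
rewrite sumEFin sumr_const lee_fin => le.
rewrite -[leRHS]mul1r ler_pdivlMr ?mulr_natr//.
by rewrite ltr0n card_words expn_gt0 (ncopies_gt0 hL hF).
Qed.
End CellMeasures.

(** * Weak convergence of the normalized measures *)

Lemma dist_le_third (R : realFieldType) (z x y e : R) : 0 < e ->
  `|x - z| <= e / 3 -> `|y - z| <= e / 3 -> `|x - y| < e.
Proof.
move=> e0 xz yz; rewrite -[x - y](subrKA z) (le_lt_trans (ler_normD _ _))//.
rewrite [`|z - y|]distrC; lra.
Qed.

Section WeakConvergence.
Context {R : realType} {d L : nat}.
Local Notation V := 'rV[R]_d.
Hypothesis hL : (3 <= L)%N.
Context (F1 : set V) (hF : is_GSC L F1).
Context (lam : {measure set V -> \bar R}) (hlam : is_lebesgue lam).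
Context (mu : probability V R)
  (hmu : normalized_restriction (hausdorff_measure (hausdorff_dim L F1)) (carpet L F1) mu).
Context (mum : nat -> probability V R)
  (hmum : forall m, normalized_restriction lam (prefractal L F1 m) (mum m)).
Local Notation Fn := (prefractal L F1).
Local Notation F := (carpet L F1).
Local Notation Cube := (@unit_cube R d).

(** Both integrals are compared with the average of v over the lower corners of the
    cells of level m: the two measures see the same cells. *)
Lemma prefractal_weak_cvg (v : V -> R) : continuous v ->
  (exists2 M : R, 0 < M & forall x, `|v x| <= M) ->
  \int[mum m]_(x in Fn m) v x @[m --> \oo] --> \int[mu]_(x in F) v x.
Proof.
move=> cv vM; apply/cvgrPdist_lt => e e0.
have e30 : 0 < e / 3 by rewrite divr_gt0.
have mv := continuous_measurable_rV cv.
have := continuous_uniform_cube hL cv e30; apply: filterS => m osc.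
have C0 : Cube 0 by move=> i; rewrite mxE lexx ler01.
have I0 : (0 < #|{: m.-tuple (letter (L := L) F1)}|)%N.
  by rewrite (card_words hL hF) expn_gt0 (ncopies_gt0 hL hF).
pose b (w : m.-tuple (letter (L := L) F1)) := v (word_map w 0).
have cell w x : (word_map (F1 := F1) (tval w) @` Cube) x -> `|v x - b w| <= e / 3.
  move=> [y Cy <-]; apply/ltW; apply: osc; try exact: (word_map_cube hL).
  by have := word_map_diam w Cy C0; rewrite size_tuple.
have cF := @carpet_compact _ _ _ hL _ hF.
have Av : `|\int[mu]_(x in F) v x - (\sum_w b w) / #|{: m.-tuple (letter (L := L) F1)}|%:R| <= e / 3.
  apply: (cover_integral_average (A := fun w : m.-tuple (letter (L := L) F1) => word_map w @` F)) => //.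
  - exact: measurable_carpet.
  - exact: normalized_full (measurable_carpet hL hF) hmu.
  - by move=> w; exact: measurable_word_map.
  - exact: word_carpet.
  - exact: carpet_cell_measure_le.
  - exact: measurable_funTS.
  - by move=> w; exists (word_map w 0).
  - move=> w x _ [y Fy yx]; apply: cell; exists y => //; exact: (Fy 0%N I).
have Am : `|\int[mum m]_(x in Fn m) v x - (\sum_w b w) / #|{: m.-tuple (letter (L := L) F1)}|%:R| <= e / 3.
  apply: (cover_integral_average (A := fun w : m.-tuple (letter (L := L) F1) => word_map w @` Cube)) => //.
  - exact: measurable_prefractal.
  - exact: normalized_full (measurable_prefractal hL hF m) (hmum m).
  - by move=> w; apply: measurable_word_map; exact: unit_cube_compact.
  - by rewrite -(word_prefractal hL hF).
  - exact: (prefractal_cell_measure_le hL hF hlam (hmum m)).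
  - exact: measurable_funTS.
  - by move=> w; exists (word_map w 0).
  - by move=> w x _; exact: cell.
exact: dist_le_third Av Am.
Qed.
End WeakConvergence.

(** * Evaluation of paths *)

Section Processes.
Context {R : realType} {d : nat}.
Local Notation V := 'rV[R]_d.

Lemma at_time_continuous (t : R) : continuous (@at_time R d t).
Proof.
apply/continuousP => O oO.
pose j (w : cpath R d) : {compact-open, halfline R -> V} := (w : halfline R -> V).
have -> : at_time t @^-1` O = j @^-1` [set g | g @` [set clock t] `<=` O].
  apply/seteqP; split=> w; first by move=> Ow _ [_ -> <-].
  by move=> h; apply: h; exists (clock t).
have /continuousP := @initial_continuous _ _ j; apply.
by apply: compact_open_open => //; exact: compact_set1.
Qed.

Lemma open_measurable_cpath (A : set (cpath R d)) : open A -> measurable A.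
Proof. by move=> oA; apply: sub_sigma_algebra. Qed.

Lemma continuous_measurable_cpath (f : cpath R d -> R) : continuous f -> measurable_fun setT f.
Proof.
move=> /continuousP cf; apply: (measurability _ (RGenOpens.measurableE R)).
move=> _ [_ [a [b ->] <-]]; rewrite setTI.
by apply: open_measurable_cpath; apply: cf; exact: interval_open.
Qed.

(** The paths stay in K, so that f may be replaced by a continuous extension, whose
    value at time t is a continuous functional of the path. *)
Lemma transition_continuous_ext (K : set V) (P : V -> probability (cpath R d) R)
    (t : R) (f g : V -> R) (x : V) :
  is_diffusion K P -> closed K -> K x -> 0 <= t -> continuous g ->
  (exists2 M : R, 0 < M & forall y, `|g y| <= M) -> (forall y, K y -> f y = g y) ->
  transition K P t f x = \int[P x]_w g (at_time t w).
Proof.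
move=> dP cK Kx t0 cg [M M0 gM] fg.
have at_closed s : closed (at_time s @^-1` K : set (cpath R d)).
  by apply: (proj1 (continuous_closedP _)) => //; exact: at_time_continuous.
have mA s : measurable (at_time s @^-1` K : set (cpath R d)).
  by rewrite -[X in measurable X]setCK; apply: measurableC; apply: open_measurable_cpath; exact: closed_openC.
set A := (at_time t @^-1` K : set (cpath R d)).
set stay := [set w : cpath R d | forall s : R, 0 <= s -> K (at_time s w)].
have mstay : measurable stay.
  rewrite -[X in measurable X]setCK; apply: measurableC; apply: open_measurable_cpath.
  apply: closed_openC; have -> : stay = \bigcap_(s in [set s : R | 0 <= s]) (at_time s @^-1` K).
    by apply/seteqP; split=> w h s; [apply: h|move=> s0; exact: (h s)].
  by apply: closed_bigI => s _.
have PA : P x (~` A) = 0%E.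
  apply/eqP; rewrite -measure_le0; apply: (@le_trans _ _ (P x (~` stay))).
    apply: le_measure; rewrite ?inE.
    - by apply: measurableC; exact: mA.
    - exact: measurableC.
    - by move=> w nA st; apply: nA; exact: st.
  by rewrite probability_setC// (diff_stay dP Kx) subee.
have cgt : continuous (g \o @at_time R d t).
  by move=> w; apply: continuous_comp; [exact: at_time_continuous|exact: cg].
have mg := continuous_measurable_cpath cgt.
have Ig : (P x).-integrable setT (EFin \o (g \o @at_time R d t)).
  apply: (@le_integrable _ _ _ _ _ _ _ (EFin \o cst M)) => //.
  - exact/measurable_EFinP.
  - by move=> w _ /=; rewrite lee_fin (ger0_norm (ltW M0)).
  exact: finite_measure_integrable_cst.
have gA : (f \_ K) \o @at_time R d t = (g \o @at_time R d t) \_ A.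
  apply/funext => w; rewrite /= !patchE.
  have -> : (w \in A) = (at_time t w \in K) by apply/idP/idP => /set_mem h; apply/mem_set.
  by case: ifP => // /set_mem/fg.
rewrite /transition -[LHS]/(\int[P x]_w ((f \_ K) \o @at_time R d t) w) gA -Rintegral_mkcond.
have mAc : measurable (~` A) by apply: measurableC; exact: mA.
have := negligible_integral mAc measurableT Ig PA.
by rewrite setTD setCK => E; congr fine; rewrite -E.
Qed.

Lemma at_time_time_change (a t : R) (w : cpath R d) : 0 <= t ->
  at_time t (time_change a w) = at_time (a * t) w.
Proof.
move=> t0; have E : set_val (clock t) = t :> R by exact: (max_idPl t0).
by rewrite /at_time -[LHS]/(w (clock (a * set_val (clock t)))) E.
Qed.
End Processes.

(** * Strong convergence in varying L^2 spaces *)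

Lemma dist_lt_three_thirds (R : realFieldType) (a b c x e : R) :
  `|b - a| < e / 3 -> `|b - c| < e / 3 -> `|x - c| < e / 3 -> `|a - x| < e.
Proof.
rewrite !ltr_norml => /andP[? ?] /andP[? ?] /andP[? ?]; apply/andP; split; lra.
Qed.

Section Limits.
Context {R : realType}.
Implicit Types (u : nat -> \bar R).

Lemma limn_esup_lt_near u (x : \bar R) : (limn_esup u < x)%E ->
  \forall n \near \oo, (u n < x)%E.
Proof.
move=> /ereal_inf_lt[_ [A [N _ NA] <-] lt]; exists N => // n /NA An.
by apply: le_lt_trans lt; apply: ereal_sup_ubound; exists n.
Qed.

Lemma limn_esup_le_near u (x : \bar R) : (\forall n \near \oo, (u n <= x)%E) ->
  (limn_esup u <= x)%E.
Proof.
move=> ux; apply: le_trans (ereal_inf_lbound _) _.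
  by exists [set n | (u n <= x)%E].
by apply: ge_ereal_sup => _ [n /= ? <-].
Qed.

Lemma limn_esup_ge0 u : (forall n, (0 <= u n)%E) -> (0 <= limn_esup u)%E.
Proof.
move=> u0; apply: le_ereal_inf_tmp => _ [A [N _ NA] <-].
by apply: le_trans (u0 N) _; apply: ereal_sup_ubound; exists N => //; apply: NA => /=.
Qed.

Lemma limn_einf_ge_cvg u (a : nat -> R) (l : R) : a n @[n --> \oo] --> l ->
  (forall n, ((a n)%:E <= u n)%E) -> (l%:E <= limn_einf u)%E.
Proof.
move=> al au; rewrite /limn_einf leeNr; apply/lee_addgt0Pr => e e0.
rewrite -EFinN -EFinD; apply: limn_esup_le_near.
move/cvgrPdist_lt : al => /(_ _ e0); apply: filterS => n /=.
rewrite ltr_norml => /andP[_ lt]; rewrite leeNl -EFinN.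
by apply: le_trans (au n); rewrite lee_fin; lra.
Qed.

(** Take for kappa m the largest k <= m such that C k m holds. *)
Lemma diagonal (C : nat -> nat -> Prop) : (forall k, \forall m \near \oo, C k m) ->
  exists kappa : nat -> nat, forall k0, \forall m \near \oo,
    (k0 <= kappa m)%N /\ C (kappa m) m.
Proof.
move=> hC; exists (fun m => \max_(k < m.+1 | `[< C k m >]) (k : nat)) => k0.
near=> m; have Ck0 : C k0 m by near: m.
have k0m : (k0 < m.+1)%N by rewrite ltnS; near: m; exists k0.
have k0A : (Ordinal k0m) \in [pred k : 'I_m.+1 | `[< C k m >]] by rewrite unfold_in /=; apply/asboolP.
split; first exact: (leq_bigmax_cond (F := fun k : 'I_m.+1 => k : nat) (Ordinal k0m)).
have [|k kA ->] := @eq_bigmax_cond _ [pred k : 'I_m.+1 | `[< C k m >]] (fun k => k : nat).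
  by apply/card_gt0P; exists (Ordinal k0m).
by move: kA; rewrite unfold_in /= => /asboolP.
Unshelve. all: by end_near. Qed.

End Limits.

Lemma add_lt_of_thirds (R : realFieldType) (a b c x e : R) :
  x <= a + b -> a < e / 3 -> b < e / 3 -> c < e / 3 -> x + c < e.
Proof. lra. Qed.

Lemma cvg_polarization (R : realType) (a b c : nat -> R) (x y z : R) :
  a n @[n --> \oo] --> x -> b n @[n --> \oo] --> y -> c n @[n --> \oo] --> z ->
  (a n ^+ 2 + b n ^+ 2 - c n ^+ 2) / 2 @[n --> \oo] --> (x ^+ 2 + y ^+ 2 - z ^+ 2) / 2.
Proof.
move=> ax By cz; have sq (u : nat -> R) (l : R) : u n @[n --> \oo] --> l ->
    u n ^+ 2 @[n --> \oo] --> l ^+ 2 by move=> ul; exact: (cvgM ul ul).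
exact: (cvgM (cvgB (cvgD (sq _ _ ax) (sq _ _ By)) (sq _ _ cz)) (cvg_cst _)).
Qed.

Section StrongConvergence.
Context {R : realType} {d : nat}.
Local Notation V := 'rV[R]_d.
Context (Kn : nat -> set V) (mun : nat -> probability V R) (In : nat -> V -> V)
        (K : set V) (mu : probability V R).
Hypothesis KKn : forall n, K `<=` Kn n.
Hypothesis mKn : forall n, measurable (Kn n).
Hypothesis cK : compact K.
Hypothesis hIn : identification_maps Kn In K.
Hypothesis weak : forall v : V -> R, continuous v ->
  (exists2 M : R, 0 < M & forall x, `|v x| <= M) ->
  \int[mun m]_(x in Kn m) v x @[m --> \oo] --> \int[mu]_(x in K) v x.
Local Notation nrmn n := (L2nrm (mun n) (Kn n)).
Local Notation nrm := (L2nrm mu K).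
Local Notation L2n n := (L2 (mun n) (Kn n)).

Let mK : measurable K.
Proof. by apply: closed_measurable_rV; apply: compact_closed; [exact: norm_hausdorff|exact: cK]. Qed.

Lemma CK_L2 u : CK K u -> L2 mu K u.
Proof.
move=> cu; have [M M0 uM] := CK_bounded cK cu.
by have [] := L2_bounded mu mK (CK_measurable cK cu) (ltW M0) uM.
Qed.

Lemma continuous_L2n n (v : V -> R) : continuous v ->
  (exists2 M : R, 0 < M & forall x, `|v x| <= M) -> L2n n v.
Proof.
move=> cv [M M0 vM].
have mv : measurable_fun (Kn n) v by apply: measurable_funTS; exact: continuous_measurable_rV.
by have [] := L2_bounded (mun n) (mKn n) mv (ltW M0) (fun x _ => vM x).
Qed.

Lemma measurable_pullback n u : CK K u -> measurable_fun (Kn n) (u \o In n).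
Proof.
move=> cu; have [/(_ n)[mI IK] _] := hIn.
exact: (measurable_comp mK IK (CK_measurable cK cu) mI).
Qed.

Lemma pullback_L2n n u : CK K u -> L2n n (u \o In n).
Proof.
move=> cu; have [M M0 uM] := CK_bounded cK cu.
have uIM x : Kn n x -> `|(u \o In n) x| <= M.
  by move=> Kx; apply: uM; have [/(_ n)[_ IK] _] := hIn; apply: IK; exists x.
by have [] := L2_bounded (mun n) (mKn n) (measurable_pullback cu) (ltW M0) uIM.
Qed.

Lemma uniform_L2_close (h : nat -> V -> R) (u : V -> R) :
  (forall n, measurable_fun (Kn n) (h n)) -> CK K u ->
  (forall e : R, 0 < e -> \forall n \near \oo, forall y, Kn n y -> `|h n y - u (In n y)| < e) ->
  forall e : R, 0 < e -> \forall n \near \oo, nrmn n (h n \- (u \o In n)) < e.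
Proof.
move=> mh cu hu e e0; have e20 : 0 < e / 2 by rewrite divr_gt0.
apply: filterS (hu _ e20) => n hn.
have m : measurable_fun (Kn n) (h n \- (u \o In n)).
  by apply: measurable_funB => //; exact: measurable_pullback.
have [_ le] := L2_bounded (mun n) (mKn n) m (ltW e20) (fun y Ky => ltW (hn y Ky)).
by apply: le_lt_trans le _; rewrite ltr_pdivrMr// ltr_pMr// ltr1n.
Qed.

Lemma extension_close (u v : V -> R) : CK K u -> continuous v ->
  (forall x, K x -> u x = v x) ->
  forall e : R, 0 < e -> \forall n \near \oo, nrmn n (v \- (u \o In n)) < e.
Proof.
move=> cu cv uv; apply: uniform_L2_close => //.
  by move=> n; apply: measurable_funTS; exact: continuous_measurable_rV.
apply: (sequential_limit_uniform KKn hIn cK (h := fun=> v)) => // x_ x _ Kx xx.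
by rewrite uv//; apply: cvg_comp xx _; exact: cv.
Qed.

Lemma cvg_pullback_nrm u : CK K u -> nrmn n (u \o In n) @[n --> \oo] --> nrm u.
Proof.
move=> cu; have [v [uv cv [M M0 vM]]] := compact_extension cK cu.
have vn : nrmn n v @[n --> \oo] --> nrm u.
  apply: (cvg_comp (fun n => L2inner (mun n) (Kn n) v v) Num.sqrt); last exact: sqrt_continuous.
  rewrite (_ : L2inner mu K u u = \int[mu]_(x in K) (v x * v x)); last first.
    by apply: eq_Rintegral => x /set_mem Kx; rewrite uv.
  apply: (weak (v := fun x => v x * v x)); first by move=> x; exact: (continuousM (cv x) (cv x)).
  by exists (M * M) => [|x]; rewrite ?mulr_gt0// normrM ler_pM.
apply/cvgrPdist_lt => e e0; have e20 : 0 < e / 2 by rewrite divr_gt0.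
move/cvgrPdist_lt : vn => /(_ _ e20).
apply: filterS2 (extension_close cu cv uv e20) => n close vn.
have Lv : L2n n v by apply: continuous_L2n => //; exists M.
have := L2nrm_dist (mKn n) Lv (pullback_L2n n cu).
move=> /le_lt_trans/(_ close) d2; rewrite -[X in `|X|](subrKA (nrmn n v)).
by rewrite (le_lt_trans (ler_normD _ _))// (splitr e) ltrD.
Qed.

(** The double limit in the definition, with one approximant for each precision. *)
Lemma strong_cvgP (fn : nat -> V -> R) (f : V -> R) :
  strong_cvg Kn (fun n => mun n) In K mu fn f <->
  [/\ forall n, L2n n (fn n), L2 mu K f & forall e : R, 0 < e ->
    exists u, [/\ CK K u, nrm (u \- f) < e &
      \forall n \near \oo, nrmn n (fn n \- (u \o In n)) < e]].
Proof.
split=> -[Lfn Lf].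
  move=> [u [cu uf ufn]]; split=> // e e0.
  have LB j : L2 mu K (u j \- f) by apply: L2B => //; exact: CK_L2.
  have uf' : nrm (u j \- f) @[j --> \oo] --> (0 : R).
    apply: (@fine_cvg _ _ _ _ (fun j => (nrm (u j \- f))%:E)).
    apply: cvg_trans uf; apply: near_eq_cvg; apply: nearW => j.
    by rewrite L2normE.
  have e0' : (0 < e%:E)%E by rewrite lte_fin.
  have near2 : \forall j \near \oo, (limn_esup (fun n =>
      L2norm (mun n) (Kn n) (fn n \- (u j \o In n))%R) < e%:E)%E.
    by apply: (ufn [set y | (y < e%:E)%E]); exact: open_ereal_lt'.
  move/cvgrPdist_lt : uf' => /(_ _ e0) near1.
  have [j [small lim]] := filter_ex (filterI near1 near2).
  exists (u j); split=> //; first by move: small; rewrite sub0r normrN ger0_norm// L2nrm_ge0.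
  apply: filterS (limn_esup_lt_near lim) => n.
  by rewrite L2normE ?lte_fin//; apply: L2B => //; exact: pullback_L2n.
move=> close; split=> //.
have pos (j : nat) : 0 < j.+1%:R^-1 :> R by rewrite invr_gt0.
have [u hu] := choice (fun j => close _ (pos j)).
exists u; split=> [j||]; first by case: (hu j).
  apply: (@squeeze_cvge _ _ _ _ (cst 0%E) _ (EFin \o @harmonic R)).
  - apply: nearW => j; have [cu le _] := hu j.
    by rewrite Lnorm_ge0 /= L2normE ?lee_fin ?(ltW le)//; apply: L2B => //; exact: CK_L2.
  - exact: cvg_cst.
  - exact: cvge_harmonic.
apply: (@squeeze_cvge _ _ _ _ (cst 0%E) _ (EFin \o @harmonic R)).
- apply: nearW => j; have [cu _ le] := hu j; apply/andP; split.
    by apply: limn_esup_ge0 => n; exact: Lnorm_ge0.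
  apply: limn_esup_le_near; apply: filterS le => n le.
  by rewrite L2normE ?lee_fin ?(ltW le)//; apply: L2B => //; exact: pullback_L2n.
- exact: cvg_cst.
- exact: cvge_harmonic.
Qed.

Local Notation strong := (strong_cvg Kn (fun n => mun n) In K mu).

Lemma strong_cvgB fn f gn g : strong fn f -> strong gn g ->
  strong (fun n => fn n \- gn n) (f \- g).
Proof.
move=> /strong_cvgP[Lfn Lf hf] /strong_cvgP[Lgn Lg hg]; apply/strong_cvgP; split.
- by move=> n; exact: L2B.
- exact: L2B.
move=> e e0; have e20 : 0 < e / 2 by rewrite divr_gt0.
have [u [cu uf ufn]] := hf _ e20; have [v [cv vg vgn]] := hg _ e20.
have comm (a b c k : V -> R) : (a \- b) \- (c \- k) = (a \- c) \- (b \- k).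
  by apply/funext => x /=; ring.
exists (u \- v); split; first exact: CK_B.
  rewrite comm (splitr e); apply: le_lt_trans (L2nrmB_le mK _ _) (ltrD uf vg).
  - by apply: L2B => //; exact: CK_L2.
  - by apply: L2B => //; exact: CK_L2.
apply: filterS2 ufn vgn => n ufn vgn.
rewrite [X in _ \- X](_ : _ = (u \o In n) \- (v \o In n))// comm (splitr e).
apply: le_lt_trans (L2nrmB_le (mKn n) _ _) (ltrD ufn vgn).
- by apply: L2B => //; exact: pullback_L2n.
- by apply: L2B => //; exact: pullback_L2n.
Qed.

Lemma strong_cvg_nrm fn f : strong fn f -> nrmn n (fn n) @[n --> \oo] --> nrm f.
Proof.
move=> /strong_cvgP[Lfn Lf hf]; apply/cvgrPdist_lt => e e0.
have e30 : 0 < e / 3 by rewrite divr_gt0.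
have [u [cu uf ufn]] := hf _ e30.
move/cvgrPdist_lt : (cvg_pullback_nrm cu) => /(_ _ e30).
apply: filterS2 ufn => n ufn un.
have d1 := L2nrm_dist mK (CK_L2 cu) Lf.
have d2 := L2nrm_dist (mKn n) (Lfn n) (pullback_L2n n cu).
have {}d1 := le_lt_trans d1 uf; have {}d2 := le_lt_trans d2 ufn.
exact: dist_lt_three_thirds d1 un d2.
Qed.

(** By polarization it is enough that norms converge, because differences of strongly
    convergent sequences converge strongly. *)
Lemma strong_cvg_inner fn f gn g : strong fn f -> strong gn g ->
  L2inner (mun n) (Kn n) (fn n) (gn n) @[n --> \oo] --> L2inner mu K f g.
Proof.
move=> sf sg; have [Lfn Lf _] := sf; have [Lgn Lg _] := sg.
have := strong_cvg_nrm (strong_cvgB sf sg).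
have := strong_cvg_nrm sf; have := strong_cvg_nrm sg => cg cf cfg.
rewrite (inner_polar mK Lf Lg).
rewrite (_ : (fun n => _) = (fun n => (nrmn n (fn n) ^+ 2 + nrmn n (gn n) ^+ 2
    - nrmn n (fn n \- gn n) ^+ 2) / 2)); last first.
  by apply/funext => n; rewrite inner_polar.
exact: cvg_polarization.
Qed.

Lemma strong_cvg_perturb fn f gn : strong fn f -> (forall n, L2n n (gn n)) ->
  (forall e : R, 0 < e -> \forall n \near \oo, nrmn n (gn n \- fn n) < e) -> strong gn f.
Proof.
move=> /strong_cvgP[Lfn Lf hf] Lgn close; apply/strong_cvgP; split=> // e e0.
have e20 : 0 < e / 2 by rewrite divr_gt0.
have [u [cu uf ufn]] := hf _ e20; exists u; split=> //.
  by apply: lt_trans uf _; rewrite ltr_pdivrMr// ltr_pMr// ltr1n.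
apply: filterS2 ufn (close _ e20) => n ufn gfn.
rewrite (splitr e); apply: le_lt_trans (L2nrm_triangle (mKn n) (Lgn n) (Lfn n) _) (ltrD gfn ufn).
exact: pullback_L2n.
Qed.

(** With u k -> f in L^2, pull back u (kappa m), where kappa grows so slowly that the
    distances of u k to all previous u j are already well reproduced on the m-th
    space. *)
Lemma strong_cvg_exists f : L2 mu K f ->
  (forall e : R, 0 < e -> exists2 u, CK K u & nrm (u \- f) < e) ->
  exists fn, strong fn f.
Proof.
move=> Lf dense.
have pick (j : nat) : exists u, CK K u /\ nrm (u \- f) < j.+1%:R^-1.
  have [|u cu uf] := dense j.+1%:R^-1; first by rewrite invr_gt0.
  by exists u.
have {pick} [u hu] := choice pick.
have cu j := (hu j).1; have uf j := (hu j).2.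
(* All previous approximants are compared with u k at once, since kappa m is not
   known in advance. *)
pose C k m := forall j, (j <= k)%N ->
  nrmn m ((u k \o In m) \- (u j \o In m)) < nrm (u k \- u j) + k.+1%:R^-1.
have [kappa hk] : exists kappa : nat -> nat, forall k0, \forall m \near \oo,
    (k0 <= kappa m)%N /\ C (kappa m) m.
  apply: diagonal => k.
  have : \forall m \near \oo, forall j : 'I_k.+1,
      nrmn m ((u k \- u j) \o In m) < nrm (u k \- u j) + k.+1%:R^-1.
    apply: filter_forall => j.
    by apply: (cvgr_lt _ (cvg_pullback_nrm (CK_B (cu k) (cu j)))); rewrite ltrDl invr_gt0.
  by apply: filterS => m h j jk; exact: (h (Ordinal (jk : (j < k.+1)%N))).
exists (fun m => u (kappa m) \o In m); apply/strong_cvgP; split=> //.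
  by move=> n; exact: pullback_L2n.
move=> e e0; have e30 : 0 < e / 3 by rewrite divr_gt0.
have /cvgrPdist_lt/(_ _ e30)[k0 _ hk0] := @cvg_harmonic R.
have small k : (k0 <= k)%N -> k.+1%:R^-1 < e / 3.
  by move=> /hk0; rewrite /= sub0r normrN ger0_norm// invr_ge0.
exists (u k0); split=> //.
  apply: lt_trans (uf k0) _; apply: lt_trans (small k0 _) _ => //.
  by rewrite ltr_pdivrMr// ltr_pMr// ltr1n.
apply: filterS (hk k0) => m [km Cm].
apply: lt_trans (Cm _ km) _.
have tri : nrm (u (kappa m) \- u k0) <= nrm (u (kappa m) \- f) + nrm (f \- u k0).
  by apply: L2nrm_triangle => //; exact: CK_L2.
have s1 := lt_trans (uf (kappa m)) (small _ km).
have s2 := lt_trans (uf k0) (small _ (leqnn k0)).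
have s3 := small _ km.
by apply: (add_lt_of_thirds tri s1 _ s3); rewrite L2nrmBC.
Qed.
End StrongConvergence.

(** * Mosco convergence from convergence of semigroups *)

Lemma rescale_quotient (R : realFieldType) (a t x : R) : a != 0 -> t != 0 ->
  a * (x / (a * t)) = x / t.
Proof. by move=> a0 t0; field; rewrite a0 t0. Qed.

(** The quotient form q is nonnegative, and this is q (f - g) >= 0 expanded.  The
    right-hand side is quadratic in f while the left-hand side is affine in f, which
    makes it continuous for weak convergence. *)
Lemma quotient_lower_bound {R : realType} {d : nat} (nu : {measure set 'rV[R]_d -> \bar R})
    (K : set 'rV[R]_d) (E : dform R d) (T : R -> ('rV[R]_d -> R) -> 'rV[R]_d -> R)
    (t : R) (f g : 'rV[R]_d -> R) :
  measurable K -> is_semigroup_of nu K E T -> 0 <= t -> L2 nu K f -> L2 nu K g ->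
  2 * L2inner nu K f (g \- T t g) - L2inner nu K g (g \- T t g)
    <= L2inner nu K (f \- T t f) f.
Proof.
move=> mK sgT t0 Lf Lg.
have Lfg := L2B mK Lf Lg; have LTf := sg_L2 sgT t0 Lf; have LTg := sg_L2 sgT t0 Lg.
have LTB := L2B mK LTf LTg; have LTfg := sg_L2 sgT t0 Lfg.
have := semigroup_quotient_ge0 mK sgT t0 Lfg.
rewrite (innerBl mK Lfg LTfg Lfg).
rewrite (aeeq_inner mK LTfg LTB Lfg (semigroupB sgT t0 Lf Lg)).
rewrite !(innerBl mK, innerBr mK)//.
rewrite (sg_sym sgT t0 Lf Lg) (innerC nu K (T t g) f) (innerC nu K (T t g) g) (innerC nu K g f).
lra.
Qed.

Section MoscoOfSemigroups.
Context {R : realType} {d : nat}.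
Local Notation V := 'rV[R]_d.
Context (Kn : nat -> set V) (mun : nat -> probability V R) (In : nat -> V -> V)
        (K : set V) (mu : probability V R).
Hypothesis KKn : forall n, K `<=` Kn n.
Hypothesis mKn : forall n, measurable (Kn n).
Hypothesis cK : compact K.
Hypothesis hIn : identification_maps Kn In K.
Hypothesis weak : forall v : V -> R, continuous v ->
  (exists2 M : R, 0 < M & forall x, `|v x| <= M) ->
  \int[mun m]_(x in Kn m) v x @[m --> \oo] --> \int[mu]_(x in K) v x.
Hypothesis dense : forall f, L2 mu K f ->
  forall e : R, 0 < e -> exists2 u, CK K u & L2nrm mu K (u \- f) < e.
Local Notation nrmn n := (L2nrm (mun n) (Kn n)).
Local Notation nrm := (L2nrm mu K).
Local Notation L2n n := (L2 (mun n) (Kn n)).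
Local Notation strong := (strong_cvg Kn (fun n => mun n) In K mu).

Context (E : dform R d) (T : R -> (V -> R) -> V -> R).
Context (En : nat -> dform R d) (Tn : nat -> R -> (V -> R) -> V -> R) (al : nat -> R).
Hypothesis sgT : is_semigroup_of mu K E T.
Hypothesis sgTn : forall n, is_semigroup_of (mun n) (Kn n) (En n) (Tn n).
Hypothesis al_gt0 : forall n, 0 < al n.
Hypothesis strong_semigroup : forall (t : R) fn f, 0 < t -> strong fn f ->
  strong (fun n => Tn n (al n * t) (fn n)) (T t f).
Local Notation En' := (fun n f => ((al n)%:E * qform (En n) f)%E).

Let mK : measurable K.
Proof. by apply: closed_measurable_rV; apply: compact_closed; [exact: norm_hausdorff|exact: cK]. Qed.

Let strongB fn f gn g := @strong_cvgB _ _ _ mun In K mu mKn cK hIn fn f gn g.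

Let strong_inner fn f gn g :=
  @strong_cvg_inner _ _ _ mun In K mu KKn mKn cK hIn weak fn f gn g.

(** Running the semigroup at speed al n multiplies its form by al n. *)
Lemma scaled_quotient_le_form n (t : R) f : 0 < t -> L2n n f ->
  ((L2inner (mun n) (Kn n) (f \- Tn n (al n * t) f) f / t)%:E <= En' n f)%E.
Proof.
move=> t0 Lf; have at0 : 0 < al n * t by rewrite mulr_gt0.
have := semigroup_quotient_le_form (mKn n) (sgTn n) at0 Lf.
move=> /(lee_wpmul2l (_ : 0 <= (al n)%:E)%E); rewrite lee_fin (ltW (al_gt0 n)) => /(_ isT).
by apply: le_trans; rewrite -EFinM rescale_quotient ?gt_eqF.
Qed.

Lemma scaled_form_le_quotient n (t : R) f : 0 < t -> L2n n f ->
  (En' n (Tn n (al n * (t / 2)) f) <=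
   (L2inner (mun n) (Kn n) (f \- Tn n (al n * t) f) f / t)%:E)%E.
Proof.
move=> t0 Lf; have at0 : 0 < al n * t by rewrite mulr_gt0.
have := form_semigroup_le_quotient (mKn n) (sgTn n) at0 Lf; rewrite -mulrA.
move=> /(lee_wpmul2l (_ : 0 <= (al n)%:E)%E); rewrite lee_fin (ltW (al_gt0 n)) => /(_ isT).
by move=> /le_trans; apply; rewrite -EFinM rescale_quotient ?gt_eqF.
Qed.

(** For fixed t > 0 the quotient at time t is bounded below through
    quotient_lower_bound by an expression in a strongly convergent gn -> f, whose limit
    is the quotient of f; then t tends to 0. *)
Lemma mosco_liminf fn f : weak_cvg Kn (fun n => mun n) In K mu fn f ->
  (qform E f <= limn_einf (fun n => En' n (fn n)))%E.
Proof.
move=> [Lfn Lf wk]; apply: cvge_to_le (sg_form sgT Lf) _.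
near=> t; have t0 : 0 < t by near: t; exact: nbhs_right_gt.
have [gn sg] := strong_cvg_exists KKn mKn cK hIn weak Lf (dense Lf).
have [Lgn _ _] := sg.
have sgB := strongB sg (strong_semigroup t0 sg).
apply: (limn_einf_ge_cvg (a := fun n =>
  (2 * L2inner (mun n) (Kn n) (fn n) (gn n \- Tn n (al n * t) (gn n))
   - L2inner (mun n) (Kn n) (gn n) (gn n \- Tn n (al n * t) (gn n))) / t)).
  have -> : L2inner mu K (f \- T t f) f / t =
      (2 * L2inner mu K f (f \- T t f) - L2inner mu K f (f \- T t f)) / t.
    by congr (_ / _); rewrite innerC; ring.
  apply: cvgM; last exact: cvg_cst.
  apply: cvgB; last exact: strong_inner.
  by apply: cvgM; [exact: cvg_cst|exact: wk].
move=> n; apply: le_trans (scaled_quotient_le_form t0 (Lfn n)).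
rewrite lee_fin ler_pM2r ?invr_gt0//.
apply: (quotient_lower_bound (mKn n) (sgTn n)) => //.
by rewrite mulr_ge0// ltW.
Unshelve. all: by end_near. Qed.

(** Regularize any gn -> f by the semigroup for time t / 2.  The energy becomes at most
    the quotient of gn at time t, which tends to that of f and hence is asymptotically
    at most the energy of f; a diagonal sequence lets t tend to 0. *)
Lemma mosco_limsup f : L2 mu K f -> exists2 fn, strong fn f &
  (limn_esup (fun n => En' n (fn n)) <= qform E f)%E.
Proof.
move=> Lf; have [gn sg] := strong_cvg_exists KKn mKn cK hIn weak Lf (dense Lf).
have [Lgn _ _] := sg.
have [/eqP ->|finE] := boolP (qform E f == +oo%E); first by exists gn => //; exact: leey.
have {finE} [c cE] : exists c : R, qform E f = c%:E.
  by move: finE; rewrite /qform; case: ifP => //; exists (fval E f f).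
pose t k : R := k.+1%:R^-1.
have t0 k : 0 < t k by rewrite invr_gt0.
have t20 k : 0 < t k / 2 by rewrite divr_gt0.
pose fk k m := Tn m (al m * (t k / 2)) (gn m).
have Lfk k m : L2n m (fk k m).
  by apply: (sg_L2 (sgTn m)) => //; rewrite mulr_ge0// ltW.
pose del k := nrm (T (t k / 2) f \- f).
have del0 : del k @[k --> \oo] --> (0 : R).
  apply: (cvg_semigroup (u := fun k => t k / 2) mK sgT) => //.
  rewrite -(mul0r 2^-1); apply: cvgM; [exact: cvg_harmonic|exact: cvg_cst].
(* Closeness to gn instead of to f lets one condition control strong convergence. *)
pose C k m := nrmn m (fk k m \- gn m) < del k + t k /\
  (En' m (fk k m) <= (c + t k)%:E)%E.
have [kappa hk] : exists kappa : nat -> nat, forall k0, \forall m \near \oo,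
    (k0 <= kappa m)%N /\ C (kappa m) m.
  apply: diagonal => k.
  have sfk : strong (fk k) (T (t k / 2) f) by exact: strong_semigroup.
  have cn := strong_cvg_nrm KKn mKn cK hIn weak (strongB sfk sg).
  have ci := strong_inner (strongB sg (strong_semigroup (t0 k) sg)) sg.
  have ci' : L2inner (mun m) (Kn m) (gn m \- Tn m (al m * t k) (gn m)) (gn m) / t k
      @[m --> \oo] --> L2inner mu K (f \- T (t k) f) f / t k.
    by apply: cvgM => //; exact: cvg_cst.
  have lec : L2inner mu K (f \- T (t k) f) f / t k < c + t k.
    have := semigroup_quotient_le_form mK sgT (t0 k) Lf; rewrite cE lee_fin.
    by move=> /le_lt_trans; apply; rewrite ltrDl.
  have ltd : del k < del k + t k by rewrite ltrDl.
  have n1 := cvgr_lt _ cn _ ltd.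
  have n2 := cvgr_lt _ ci' _ lec.
  apply: filterS2 (n1 _) (n2 _) => m m1 m2; split=> //.
  by apply: le_trans (scaled_form_le_quotient (t0 k) (Lgn m)) _; rewrite lee_fin ltW.
exists (fun m => fk (kappa m) m).
  apply: (strong_cvg_perturb mKn cK hIn sg) => // e e0.
  have : (del k + t k) @[k --> \oo] --> (0 : R).
    by rewrite -(addr0 0); apply: cvgD => //; exact: cvg_harmonic.
  move=> /cvgr_lt/(_ e e0)[k0 _ hk0].
  apply: filterS (hk k0) => m [km [Cm _]].
  by apply: lt_trans Cm _; exact: hk0.
rewrite cE; apply/lee_addgt0Pr => e e0; apply: limn_esup_le_near.
have /cvgr_lt/(_ e e0)[k0 _ hk0] := @cvg_harmonic R.
apply: filterS (hk k0) => m [km [_ Cm]].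
apply: le_trans Cm _; rewrite -EFinD lee_fin lerD2l ltW//.
exact: hk0.
Qed.

Theorem mosco_of_semigroups :
  mosco Kn (fun n => mun n) In K mu En' (qform E).
Proof. by split; [exact: mosco_liminf|exact: mosco_limsup]. Qed.

End MoscoOfSemigroups.

(** * Convergence of the transition semigroups *)

Lemma lt_four_quarters (R : realFieldType) (a b c x y z e : R) : 0 < e ->
  x <= y + c -> y <= z -> z <= a + b -> a < e / 4 -> b < e / 4 -> c < e / 4 -> x < e.
Proof. lra. Qed.

Section ProcessConvergence.
Context {R : realType} {d : nat}.
Local Notation V := 'rV[R]_d.
Context (Kn : nat -> set V) (mun : nat -> probability V R) (In : nat -> V -> V)
        (K : set V) (mu : probability V R).
Hypothesis KKn : forall n, K `<=` Kn n.
Hypothesis clKn : forall n, closed (Kn n).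
Hypothesis cK : compact K.
Hypothesis hIn : identification_maps Kn In K.
Context (E : dform R d) (P : V -> probability (cpath R d) R).
Context (En : nat -> dform R d) (Pn : nat -> V -> probability (cpath R d) R) (al : nat -> R).
Hypothesis hP : is_diffusion_of mu K E P.
Hypothesis hPn : forall n, is_diffusion_of (mun n) (Kn n) (En n) (Pn n).
Hypothesis al_gt0 : forall n, 0 < al n.
Hypothesis hcvg : forall (x_ : nat -> V) (x : V), (forall m, Kn m (x_ m)) -> K x ->
  x_ m @[m --> \oo] --> x ->
  cvg_in_law (fun m => Pn m (x_ m)) (fun m => time_change (al m)) (P x).
Local Notation nrmn n := (L2nrm (mun n) (Kn n)).
Local Notation nrm := (L2nrm mu K).
Local Notation strong := (strong_cvg Kn (fun n => mun n) In K mu).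

Let mKn n : measurable (Kn n). Proof. by apply: closed_measurable_rV; exact: clKn. Qed.
Let clK : closed K. Proof. by apply: compact_closed; [exact: norm_hausdorff|exact: cK]. Qed.
Let mK : measurable K. Proof. by apply: closed_measurable_rV; exact: clK. Qed.

(** Evaluation at time t composed with v is a bounded continuous functional on path
    space; the time change turns t into al m * t. *)
Lemma transition_cvg (t : R) (u v : V -> R) (x_ : nat -> V) (x : V) : 0 < t ->
  continuous v -> (exists2 M : R, 0 < M & forall y, `|v y| <= M) ->
  (forall y, K y -> u y = v y) ->
  (forall m, Kn m (x_ m)) -> K x -> x_ m @[m --> \oo] --> x ->
  transition (Kn m) (Pn m) (al m * t) v (x_ m) @[m --> \oo] --> transition K P t u x.
Proof.
move=> t0 cv vM uv Kx_ Kx xx.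
have [dP _] := hP.
rewrite (transition_continuous_ext dP clK Kx (ltW t0) cv vM uv).
rewrite (_ : (fun m => _) = (fun m =>
    \int[Pn m (x_ m)]_w v (at_time t (time_change (al m) w)))); last first.
  apply/funext => m; have [dPn _] := hPn m.
  rewrite (transition_continuous_ext dPn (@clKn m) (Kx_ m) _ cv vM)//; last first.
    by rewrite mulr_ge0// ltW.
  by apply: eq_Rintegral => w _; rewrite at_time_time_change// ltW.
apply: (hcvg Kx_ Kx xx (Phi := v \o @at_time R d t)); last first.
  by case: vM => M _ vM; exists M => w; exact: vM.
by move=> w; apply: continuous_comp; [exact: at_time_continuous|exact: cv].
Qed.

(** With u close to f and v a continuous extension of u, go from T^n fn to T^n v by
    contraction, and from T^n v to the pullback of T u by uniform convergence. *)
Lemma strong_cvg_transition (t : R) fn f : 0 < t -> strong fn f ->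
  strong (fun n => transition (Kn n) (Pn n) (al n * t) (fn n)) (transition K P t f).
Proof.
move=> t0 /(strong_cvgP mun mu mKn cK hIn)[Lfn Lf hf].
have [dP sP] := hP; have at0 n : 0 <= al n * t by rewrite mulr_ge0// ltW.
apply/(strong_cvgP mun mu mKn cK hIn); split=> [n||].
- by apply: (sg_L2 (hPn n).2).
- by apply: (sg_L2 sP) => //; exact: ltW.
move=> e e0; have e40 : 0 < e / 4 by rewrite divr_gt0.
have [u [cu uf ufn]] := hf _ e40.
have Lu := CK_L2 mu cK cu.
have cTu : CK K (transition K P t u) by apply: (diff_feller dP) => //; exact: ltW.
exists (transition K P t u); split=> //.
  apply: le_lt_trans (semigroup_lipschitz mK sP (ltW t0) Lu Lf) _.
  by apply: lt_trans uf _; rewrite ltr_pdivrMr// ltr_pMr// ltr1n.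
have [v [uv cv vM]] := compact_extension cK cu.
have Lv n : L2 (mun n) (Kn n) v by apply: continuous_L2n.
have LTv n := sg_L2 (hPn n).2 (at0 n) (Lv n).
have close1 := extension_close mun KKn mKn cK hIn cu cv uv e40.
have close2 : \forall n \near \oo,
    nrmn n (transition (Kn n) (Pn n) (al n * t) v \- (transition K P t u \o In n)) < e / 4.
  apply: (uniform_L2_close mun mKn cK hIn (h := fun n => transition (Kn n) (Pn n) (al n * t) v)) => //.
    by move=> n; have [] := LTv n.
  apply: (sequential_limit_uniform KKn hIn cK (h := fun n => transition (Kn n) (Pn n) (al n * t) v)) => //.
  by move=> x_ x Kx_ Kx xx; exact: transition_cvg.
near=> n.
have Lun := pullback_L2n mun mKn cK hIn n cu.
have LTun := pullback_L2n mun mKn cK hIn n cTu.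
have LTfn := sg_L2 (hPn n).2 (at0 n) (Lfn n).
apply: (lt_four_quarters e0 (L2nrm_triangle (mKn n) LTfn (LTv n) LTun)
  (semigroup_lipschitz (mKn n) (hPn n).2 (at0 n) (Lfn n) (Lv n))
  (L2nrm_triangle (mKn n) (Lfn n) Lun (Lv n))).
- by near: n.
- by rewrite L2nrmBC; near: n.
- by near: n.
Unshelve. all: by end_near. Qed.

End ProcessConvergence.

(** The domain is dense in L^2, and in it continuous functions are dense for the
    stronger norm of the form. *)
Lemma regular_form_dense {R : realType} {d : nat} (mu : probability 'rV[R]_d R)
    (K : set 'rV[R]_d) (E : dform R d) : compact K ->
  is_dirichlet_form mu K E -> regular mu K E ->
  forall f, L2 mu K f -> forall e : R, 0 < e ->
  exists2 u, CK K u & L2nrm mu K (u \- f) < e.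
Proof.
move=> cK dE [regE _] f Lf e e0.
have mK : measurable K.
  by apply: closed_measurable_rV; apply: compact_closed; [exact: norm_hausdorff|exact: cK].
have e20 : 0 < e / 2 by rewrite divr_gt0.
have [g dg fg] := df_dense dE Lf e20.
have [h [dh ch] gh] := regE _ _ dg (exprn_gt0 2 e20).
have Lg := df_L2 dE dg; have Lh := df_L2 dE dh.
exists h => //; rewrite L2nrmBC (splitr e).
apply: le_lt_trans (L2nrm_triangle mK Lf Lg Lh) (ltrD _ _).
  by rewrite -lte_fin -L2normE//; exact: L2B.
have dgh : fdom E (g \- h).
  have := df_domD dE (-1) dh dg; congr (fdom E).
  by apply/funext => x /=; ring.
rewrite -(ltr_sqr (L2nrm_ge0 _ _ _) (ltW e20)) sqr_L2nrm; apply: le_lt_trans gh.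
by rewrite /Defs.val1 lerDr (df_ge0 dE).
Qed.

(** * Mosco convergence on the carpet *)

Theorem theorem3p12 (R : realType) (d L : nat) (hd : (2 <= d)%N)
    (hL : (3 <= L)%N) (F1 : set 'rV[R]_d) (hF : is_GSC L F1)
    (lam : {measure set 'rV[R]_d -> \bar R}) (hlam : is_lebesgue lam)
    (mu : probability 'rV[R]_d R)
    (hmu : normalized_restriction (hausdorff_measure (hausdorff_dim L F1))
             (carpet L F1) mu)
    (mum : nat -> probability 'rV[R]_d R)
    (hmum : forall m, normalized_restriction lam (prefractal L F1 m) (mum m))
    (rho : R) (hrho : is_resistance_factor L F1 lam rho)
    (PM : nat -> 'rV[R]_d -> probability (cpath R d) R)
    (hPM : forall m, is_diffusion_of (mum m) (prefractal L F1 m)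
             (prefractal_form L F1 lam rho m (mum m)) (PM m))
    (EF : dform R d) (PF : 'rV[R]_d -> probability (cpath R d) R)
    (hEF : is_carpet_BM L F1 mu EF PF)
    (alpha : nat -> R)
    (halpha_inf : (0 < ereal_inf [set (alpha m)%:E | m in setT])%E)
    (halpha_sup : (ereal_sup [set (alpha m)%:E | m in setT] < +oo)%E)
    (hcvg : forall (x_ : nat -> 'rV[R]_d) (x : 'rV[R]_d),
       (forall m, prefractal L F1 m (x_ m)) -> carpet L F1 x ->
       x_ m @[m --> \oo] --> x ->
       cvg_in_law (fun m => PM m (x_ m)) (fun m => time_change (alpha m)) (PF x))
    (In : nat -> 'rV[R]_d -> 'rV[R]_d)
    (hIn : identification_maps (prefractal L F1) In (carpet L F1)) :
  mosco (prefractal L F1) (fun m => mum m) In (carpet L F1) mu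
    (fun m f => ((alpha m)%:E * qform (prefractal_form L F1 lam rho m (mum m)) f)%E)
    (qform EF).
Proof.
have alpha_gt0 n : 0 < alpha n.
  rewrite -lte_fin; apply: lt_le_trans halpha_inf _.
  by apply: ereal_inf_lbound; exists n.
have KKn n : carpet L F1 `<=` prefractal L F1 n by move=> x Fx; exact: Fx.
have cK := @carpet_compact _ _ _ hL _ hF.
have hP := bm_diffusion hEF.
apply: (mosco_of_semigroups KKn (measurable_prefractal hL hF) cK hIn
  (prefractal_weak_cvg hL hF hlam hmu hmum)
  (regular_form_dense cK (bm_dirichlet hEF) (bm_regular hEF))
  (T := transition (carpet L F1) PF)
  (Tn := fun n => transition (prefractal L F1 n) (PM n))) => //.
- by case: hP.
- by move=> n; case: (hPM n).
move=> t fn f t0.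
exact: (strong_cvg_transition KKn (closed_prefractal hL hF) cK hIn hP hPM alpha_gt0 hcvg t0).
Qed.
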